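(* Let $S$ be a diagonal tropical Hopf manifold. Then $\mathrm{Pic}(S)\cong\mathbb{T}^*$. Moreover, every tropical line bundle on $S$ has a section.
   Context: $\mathbb{T}=\mathbb{R}\cup\{\infty\}$ is the min-plus tropical semifield (tropical multiplication is $+$), so $\mathbb{T}^*=\mathbb{R}$ as a group under usual addition; $\infty$ also denotes $(\infty,\dots,\infty)\in\mathbb{T}^d$. $\mathbb{T}$ has the topology generated by Euclidean open sets and the sets $(a,\infty]$. A diagonal tropical Hopf manifold of dimension $d$ is the quotient $S=(\mathbb{T}^d\setminus\{\infty\})/\langle F\rangle$, where $F$ is the translation by a vector $a\in(\mathbb{R}_+^* )^d$ with strictly positive entries. $\mathrm{Pic}(S):=H^1(S,\mathcal{O}_S^* )$, where $\mathcal{O}^*_S$ is the sheaf of groups (under addition) of tropical invertible regular functions: for $U\subset\mathbb{T}^d$ open, $\mathcal{O}^*(U)$ consists of functions which coincide with an integer affine function ($a+\langle k,x\rangle$, $a\in\mathbb{R}$, $k\in\mathbb{Z}^d$) on $U\cap\mathbb{R}^d$ and which do not attain the value $\infty$ when extended to $U$ (equivalently, do not involve $x_i$ whenever $U$ contains a point with $x_i=\infty$). Tropical line bundles on $S$ are the elements of $\mathrm{Pic}(S)$. A tropical line bundle has a (tropical) section if it can be represented by a tropical divisor, that is, by a codimension-one tropical cycle $Z$ of $S$: if $Z$ is given on an open cover $\{U_\alpha\}$ as $\mathrm{div}(\varphi_\alpha)$ for tropical rational functions $\varphi_\alpha$ (differences of tropical polynomial functions), its class is that of the cocycle $(\varphi_\alpha-\varphi_\beta)$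 in $\mathcal{O}^*_S(U_\alpha\cap U_\beta)$. Here the divisor of a tropical polynomial function is its corner locus with its usual integer weights, extended linearly to differences.
   Formalization: The dimension d of S is assumed to be at least 2: for d = 1, S is the circle R/aZ and Pic(S) contains R/aZ, hence has torsion and is not isomorphic to T* = R; for d = 0, S is empty. *)

(* Defs.v *)
From HB Require Import structures.
From mathcomp Require Import all_boot all_order all_algebra.
From mathcomp Require Import all_classical all_reals all_analysis.
Set Implicit Arguments.
Unset Strict Implicit.
Unset Printing Implicit Defensive.
Import Order.TTheory GRing.Theory Num.Theory.
Local Open Scope classical_set_scope.
Local Open Scope ring_scope.

(* A presheaf of G-valued functions on S.  Sections over U are encoded as total
   functions on S; only their values on U matter. *)
Record fun_presheaf (S : topologicalType) (G : zmodType) := FunPresheaf {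
  sections :> set S -> set (S -> G);
  sections0 : forall U, sections U 0;
  sectionsB : forall U f g, sections U f -> sections U g ->
    sections U (fun s => f s - g s);
  sections_res : forall U V f, V `<=` U -> sections U f -> sections V f }.

Section Cech.
Variables (S : topologicalType) (G : zmodType) (O : fun_presheaf S G).

Record cocycle := Cocycle {
  idx : Type;
  cov : idx -> set S;
  cov_open : forall i, open (cov i);
  cov_full : forall s, exists i, cov i s;
  trans : idx -> idx -> S -> G;
  trans_sec : forall i j, O (cov i `&` cov j) (trans i j);
  transD : forall i j k s, cov i s -> cov j s -> cov k s ->
    trans i j s + trans j k s = trans i k s }.

HB.instance Definition _ := gen_eqMixin cocycle.
HB.instance Definition _ := gen_choiceMixin cocycle.

(* Equality in the direct limit over refinements: c and e differ by a
   coboundary on some common open refinement W of the two covers. *)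
Definition cohomologous (c e : cocycle) : Prop :=
  exists (K : Type) (W : K -> set S) (r : K -> idx c) (t : K -> idx e)
         (f : K -> S -> G),
    [/\ forall k, open (W k),
        forall s, exists k, W k s,
        forall k, W k `<=` cov (r k) /\ W k `<=` cov (t k),
        forall k, O (W k) (f k) &
        forall k l s, W k s -> W l s ->
          trans (r k) (r l) s - trans (t k) (t l) s = f k s - f l s].

Let sectionsN U f : O U f -> O U (fun s => - f s).
Proof.
move=> Of; have := sectionsB (sections0 O U) Of.
by under eq_fun do rewrite sub0r.
Qed.

Let sectionsD U f g : O U f -> O U g -> O U (fun s => f s + g s).
Proof.
move=> Of /sectionsN Og; have := sectionsB Of Og.
by under eq_fun do rewrite opprK.
Qed.

Lemma trans_id (c : cocycle) (i : idx c) s : cov i s -> trans i i s = 0.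
Proof.
by move=> si; have := transD si si si => /(canRL (addrK _)); rewrite subrr.
Qed.

Lemma transN (c : cocycle) (i j : idx c) s :
  cov i s -> cov j s -> trans i j s = - trans j i s.
Proof.
move=> si sj; apply/eqP; rewrite -subr_eq0 opprK.
by rewrite (transD si sj si) trans_id.
Qed.

Lemma coh_refine (c e : cocycle) (t : idx c -> idx e) (f : idx c -> S -> G) :
  (forall i, cov i `<=` cov (t i)) -> (forall i, O (cov i) (f i)) ->
  (forall i j s, cov i s -> cov j s ->
    trans i j s - trans (t i) (t j) s = f i s - f j s) ->
  cohomologous c e.
Proof.
move=> ct Of fE; exists (idx c), (@cov c), id, t, f; split => //.
- by move=> k; exact: cov_open.
- exact: cov_full.
- by move=> k; split => //; exact: ct.
Qed.

Lemma coh_refine0 (c e : cocycle) (t : idx c -> idx e) :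
  (forall i, cov i `<=` cov (t i)) ->
  (forall i j s, cov i s -> cov j s -> trans i j s = trans (t i) (t j) s) ->
  cohomologous c e.
Proof.
move=> ct tE; apply: (@coh_refine _ _ t (fun _ => 0)) => //.
- by move=> i; exact: sections0.
- by move=> i j s si sj; rewrite (tE _ _ _ si sj) !subrr.
Qed.

Lemma coh_refl c : cohomologous c c.
Proof. by apply: (@coh_refine0 c c id) => [i s|]. Qed.

Lemma coh_sym c e : cohomologous c e -> cohomologous e c.
Proof.
move=> [K [W [r [t [f [Wo Wc Wr Of fE]]]]]].
exists K, W, t, r, (fun k s => - f k s); split => //.
- by move=> k; have [] := Wr k.
- by move=> k; exact: sectionsN.
- by move=> k l s Wk Wl; rewrite -opprB fE// opprD.
Qed.

Lemma coh_trans c e b :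
  cohomologous c e -> cohomologous e b -> cohomologous c b.
Proof.
move=> [K [W [r [t [f [Wo Wc Wr Of fE]]]]]].
move=> [K' [W' [r' [t' [f' [Wo' Wc' Wr' Of' fE']]]]]].
pose h (k : K * K') s := trans (t k.1) (r' k.2) s.
exists (K * K')%type, (fun k => W k.1 `&` W' k.2), (r \o fst), (t' \o snd),
  (fun k s => f k.1 s + h k s + f' k.2 s); split.
- by move=> k; exact: openI.
- by move=> s; have [k ?] := Wc s; have [k' ?] := Wc' s; exists (k, k').
- by move=> k; split => s [/= + +];
    [move=> /(Wr _).1 | move=> _ /(Wr' _).2].
- move=> k; apply: sectionsD; first apply: sectionsD.
  + exact: sections_res (@subIsetl _ _ _) (Of _).
  + apply: sections_res (trans_sec _ _) => s [Wk Wk'].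
    by split; [exact: (Wr _).2 | exact: (Wr' _).1].
  + exact: sections_res (@subIsetr _ _ _) (Of' _).
- move=> k l s [Wk Wk'] [Wl Wl'] /=.
  have tk := (Wr _).2 _ Wk; have tl := (Wr _).2 _ Wl.
  have rk := (Wr' _).1 _ Wk'; have rl := (Wr' _).1 _ Wl'.
  have hB : trans (t k.1) (t l.1) s - trans (r' k.2) (r' l.2) s = h k s - h l s.
    apply/eqP; rewrite subr_eq addrAC eq_sym subr_eq.
    by rewrite (transD tk rk rl) (transD tk tl rl).
  have -> : trans (r k.1) (r l.1) s - trans (t' k.2) (t' l.2) s =
      (trans (r k.1) (r l.1) s - trans (t k.1) (t l.1) s) +
      (trans (t k.1) (t l.1) s - trans (r' k.2) (r' l.2) s) +
      (trans (r' k.2) (r' l.2) s - trans (t' k.2) (t' l.2) s).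
    by rewrite !addrA !subrK.
  rewrite (fE _ _ _ Wk Wl) hB (fE' _ _ _ Wk' Wl').
  by rewrite !opprD [RHS]addrACA [X in _ = X + _]addrACA.
Qed.

Definition cohb (c e : cocycle) : bool := `[< cohomologous c e >].

Lemma cohb_equiv : equiv_class_of cohb.
Proof.
split.
- by move=> c; apply/asboolP; exact: coh_refl.
- by move=> c e; apply/asboolP/asboolP; exact: coh_sym.
- by move=> e c b /asboolP ce /asboolP eb; apply/asboolP; exact: coh_trans ce eb.
Qed.

Canonical coh_equiv := EquivRelPack cohb_equiv.

Definition cechH1 : Type := {eq_quot coh_equiv}%qT.

HB.instance Definition _ := Choice.on cechH1.
HB.instance Definition _ := EqQuotient.on cechH1.

Definition cocycle_class (c : cocycle) : cechH1 := \pi_cechH1%qT c.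

Lemma cocycle_classP c e :
  cocycle_class c = cocycle_class e <-> cohomologous c e.
Proof.
by split => [/eqmodP/asboolP//|ce]; apply/eqmodP/asboolP.
Qed.

Lemma cocycle_class_repr (x : cechH1) : cocycle_class (repr x) = x.
Proof. exact: reprK. Qed.

Local Obligation Tactic := idtac.

Program Definition cocycle0 : cocycle := {|
  idx := unit; cov := fun _ => setT; trans := fun _ _ => 0 |}.
Next Obligation. by move=> i; exact: openT. Qed.
Next Obligation. by move=> s; exists tt. Qed.
Next Obligation. by move=> i j; exact: sections0. Qed.
Next Obligation. by move=> *; exact: addr0. Qed.

Program Definition cocycleN (c : cocycle) : cocycle := {|
  idx := idx c; cov := @cov c; trans := fun i j s => - trans i j s |}.
Next Obligation. by move=> c i; exact: cov_open. Qed.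
Next Obligation. by move=> c; exact: cov_full. Qed.
Next Obligation. by move=> c i j; apply: sectionsN; exact: trans_sec. Qed.
Next Obligation. by move=> c i j k s si sj sk; rewrite -opprD (transD si sj sk). Qed.

Program Definition cocycleD (c e : cocycle) : cocycle := {|
  idx := (idx c * idx e)%type;
  cov := fun i => cov i.1 `&` cov i.2;
  trans := fun i j s => trans i.1 j.1 s + trans i.2 j.2 s |}.
Next Obligation. by move=> c e i; apply: openI; exact: cov_open. Qed.
Next Obligation.
move=> c e s; have [i ci] := cov_full c s; have [j ej] := cov_full e s.
by exists (i, j).
Qed.
Next Obligation.
move=> c e i j; apply: sectionsD; apply: sections_res (trans_sec _ _);
  by move=> s [[? ?] [? ?]].
Qed.
Next Obligation.
move=> c e i j k s [i1 i2] [j1 j2] [k1 k2].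
by rewrite addrACA (transD i1 j1 k1) (transD i2 j2 k2).
Qed.

Lemma cocycleD_coh c c' e e' : cohomologous c c' -> cohomologous e e' ->
  cohomologous (cocycleD c e) (cocycleD c' e').
Proof.
move=> [K [W [r [t [f [Wo Wc Wr Of fE]]]]]].
move=> [K' [W' [r' [t' [f' [Wo' Wc' Wr' Of' fE']]]]]].
exists (K * K')%type, (fun k => W k.1 `&` W' k.2),
  (fun k => (r k.1, r' k.2)), (fun k => (t k.1, t' k.2)),
  (fun k s => f k.1 s + f' k.2 s); split.
- by move=> k; exact: openI.
- by move=> s; have [k ?] := Wc s; have [k' ?] := Wc' s; exists (k, k').
- move=> k; split => s [Wk Wk']; split => /=.
  + exact: (Wr _).1.
  + exact: (Wr' _).1.
  + exact: (Wr _).2.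
  + exact: (Wr' _).2.
- move=> k; apply: sectionsD.
  + exact: sections_res (@subIsetl _ _ _) (Of _).
  + exact: sections_res (@subIsetr _ _ _) (Of' _).
- move=> k l s [Wk Wk'] [Wl Wl'] /=.
  by rewrite opprD addrACA (fE _ _ _ Wk Wl) (fE' _ _ _ Wk' Wl') -addrACA -opprD.
Qed.

Lemma cocycleN_coh c c' :
  cohomologous c c' -> cohomologous (cocycleN c) (cocycleN c').
Proof.
move=> [K [W [r [t [f [Wo Wc Wr Of fE]]]]]].
exists K, W, r, t, (fun k s => - f k s); split => //.
- by move=> k; exact: sectionsN.
- by move=> k l s Wk Wl /=; rewrite -!opprD (fE _ _ _ Wk Wl).
Qed.

Definition cech0 : cechH1 := cocycle_class cocycle0.
Definition cechN (x : cechH1) : cechH1 := cocycle_class (cocycleN (repr x)).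
Definition cechD (x y : cechH1) : cechH1 :=
  cocycle_class (cocycleD (repr x) (repr y)).

Lemma cocycle_classN c : cechN (cocycle_class c) = cocycle_class (cocycleN c).
Proof.
apply/cocycle_classP/cocycleN_coh/cocycle_classP; exact: cocycle_class_repr.
Qed.

Lemma cocycle_classD c e :
  cechD (cocycle_class c) (cocycle_class e) = cocycle_class (cocycleD c e).
Proof.
by apply/cocycle_classP/cocycleD_coh; apply/cocycle_classP;
  exact: cocycle_class_repr.
Qed.

Lemma cechDA : associative cechD.
Proof.
move=> x y z; rewrite -(cocycle_class_repr x) -(cocycle_class_repr y).
rewrite -(cocycle_class_repr z) !cocycle_classD; apply/cocycle_classP.
apply: (@coh_refine0 _ _ (fun i : idx (cocycleD _ (cocycleD _ _)) =>
  ((i.1, i.2.1), i.2.2) : idx (cocycleD (cocycleD _ _) _))).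
- by move=> i s [? [? ?]].
- by move=> i j s _ _ /=; rewrite addrA.
Qed.

Lemma cechDC : commutative cechD.
Proof.
move=> x y; rewrite -(cocycle_class_repr x) -(cocycle_class_repr y).
rewrite !cocycle_classD; apply/cocycle_classP.
apply: (@coh_refine0 _ _ (fun i : idx (cocycleD _ _) =>
  (i.2, i.1) : idx (cocycleD _ _))).
- by move=> i s [? ?].
- by move=> i j s _ _ /=; rewrite addrC.
Qed.

Lemma cech0D : left_id cech0 cechD.
Proof.
move=> x; rewrite -(cocycle_class_repr x) cocycle_classD.
apply/cocycle_classP.
apply: (@coh_refine0 _ _ (fun i : idx (cocycleD _ _) => i.2)).
- by move=> i s [? ?].
- by move=> i j s _ _ /=; rewrite add0r.
Qed.

Lemma cechND : left_inverse cech0 cechN cechD.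
Proof.
move=> x; rewrite -(cocycle_class_repr x) cocycle_classN cocycle_classD.
apply/cocycle_classP; set c := repr x.
apply: (@coh_refine (cocycleD (cocycleN c) c) cocycle0 (fun _ => tt)
  (fun i s => trans i.2 i.1 s)).
- by [].
- by move=> i; apply: sections_res (trans_sec _ _) => s [? ?].
- move=> i j s [i1 i2] [j1 j2] /=; rewrite subr0.
  apply/eqP; rewrite addrC subr_eq addrAC eq_sym subr_eq.
  by rewrite (transD i2 i1 j1) (transD i2 j2 j1).
Qed.

HB.instance Definition _ := GRing.isZmodule.Build cechH1 cechDA cechDC cech0D cechND.

End Cech.

Section TropicalSpace.
Variables (R : realType) (d : nat).

(* T^d \ {oo}, where T is \bar R without -oo: the neighbourhoods of +oo in
   \bar R are generated by the ]a, +oo]. *)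
Definition punctured : set {ptws 'I_d -> \bar R} :=
  [set x | (forall i, x i != -oo%E) /\ exists i, x i != +oo%E].

Local Notation X := (set_type punctured).

Definition coord (x : X) (i : 'I_d) : \bar R := set_val x i.

Definition finite_pt (x : X) : Prop := forall i, coord x i != +oo%E.

Definition lin (k : 'I_d -> int) (x : X) : \bar R :=
  (\sum_(i < d) (k i)%:~R%:E * coord x i)%E.

(* In \bar R one has 0 * +oo = 0, and a sum with an infinite term is infinite
   (+oo - oo = -oo).  Hence this value is finite iff no infinite coordinate of x
   is involved. *)
Definition iaff (c : R) (k : 'I_d -> int) (x : X) : \bar R :=
  (c%:E + lin k x)%E.

Lemma coord_ninfty x i : coord x i != -oo%E.
Proof. by case: x => x xP; rewrite /coord /=; case/set_mem: (xP). Qed.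

Lemma iaff_term c k x i : iaff c k x \is a fin_num ->
  k i = 0 \/ coord x i \is a fin_num.
Proof.
rewrite fin_numD => /andP[_]; rewrite sum_fin_num => /allP fin_k.
have /fin_k /= : ((k i)%:~R%:E * coord x i)%E \in
    [seq ((k i)%:~R%:E * coord x i)%E | i <- index_enum 'I_d & true].
  by apply: map_f; rewrite mem_filter mem_index_enum.
have := coord_ninfty x i; case: (coord x i) => [r||] //= _.
- by right.
- have [->|k0] := eqVneq (k i) 0; first by left.
  rewrite mulry; case: sgrP => [|_|_]; last 2 first.
  + by rewrite mul1e.
  + by rewrite EFinN mulN1e.
  + by move/eqP; rewrite intr_eq0 (negbTE k0).
Qed.

Lemma iaffB c k c' k' x :
  iaff c k x \is a fin_num -> iaff c' k' x \is a fin_num ->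
  (iaff c k x - iaff c' k' x)%E = iaff (c - c') (fun i => k i - k' i) x.
Proof.
move=> fk fk'.
have E (b : R) h : iaff b h x \is a fin_num ->
    iaff b h x = (b + \sum_(i < d) (h i)%:~R * fine (coord x i))%:E.
  move=> fh; rewrite /iaff EFinD -sumEFin; congr (_ + _)%E.
  apply: eq_bigr => i _; have [->|xf] := iaff_term i fh.
    by rewrite mul0e mul0r.
  by rewrite EFinM fineK.
have fB : iaff (c - c') (fun i => k i - k' i) x \is a fin_num.
  rewrite fin_numD /= sum_fin_num; apply/allP => _ /mapP[i _ ->] /=.
  have [k0|xf] := iaff_term i fk; last by rewrite fin_numM.
  have [k0'|xf] := iaff_term i fk'; last by rewrite fin_numM.
  by rewrite k0 k0' subrr mul0e.
rewrite (E _ _ fB) (E _ _ fk) (E _ _ fk') -EFinB; congr (_%:E).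
rewrite opprD addrACA; congr (_ + _); rewrite -sumrB.
by apply: eq_bigr => i _; rewrite rmorphB mulrBl.
Qed.

(* A nonzero tropical polynomial: its nonempty list of monomials
   c + <k, x> with exponents k in N^d. *)
Definition tpoly : Type := seq (R * ('I_d -> nat)).

Definition tpoly_eval (P : tpoly) (x : X) : \bar R :=
  \big[Order.min/+oo%E]_(m <- P) iaff m.1 (fun i => (m.2 i)%:Z) x.

(* P - Q, meaningful at the points with finite coordinates only: on the
   boundary, P and Q may take the value +oo. *)
Definition trat (P Q : tpoly) (x : X) : R :=
  fine (tpoly_eval P x) - fine (tpoly_eval Q x).

Definition primitive (v : 'I_d -> int) : Prop :=
  \big[gcdn/0%N]_(i < d) `|v i|%N = 1%N.

(* x is a generic point for the function phi, and the divisor of phi has weight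
   m there (0 if phi is affine near x).
   - If x has finite coordinates: near x, phi is the sum of an affine function
     and of m * min(0, <v, y - x>) with v primitive.  For phi a tropical
     polynomial whose extreme exponents at x are k and k + w v, m is the lattice
     length w of the edge dual to the facet of the corner locus through x, and
     m is additive in phi.  Replacing v by -v only changes the affine part.
   - If exactly one coordinate x_i is infinite: m is the order of phi along the
     boundary facet x_i = oo. *)
Definition div_weight (phi : X -> R) (x : X) (m : int) : Prop :=
  (finite_pt x /\
    exists (v : 'I_d -> int) (c : R) (k : 'I_d -> int), primitive v /\
      \forall y \near x, phi y = fine (iaff c k y) +
        m%:~R * Num.min 0 (fine (lin v y) - fine (lin v x))) \/
  (exists (i : 'I_d) (c : R) (k : 'I_d -> int),
    [/\ coord x i = +oo%E, forall j, j != i -> coord x j != +oo%E, k i = m &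
      \forall y \near x, finite_pt y -> phi y = fine (iaff c k y)]).

End TropicalSpace.

Section Hopf.
Variables (R : realType) (d : nat) (a : 'I_d -> R).

Local Notation X := (set_type (@punctured R d)).

(* y = F^n x for some n in Z, with F the translation by a. *)
Definition orbit_rel (x y : X) : bool :=
  `[< exists n : int, forall i,
        coord y i = (coord x i + (n%:~R * a i)%:E)%E >].

Lemma orbit_equiv : equiv_class_of orbit_rel.
Proof.
have sym x y : orbit_rel x y -> orbit_rel y x.
  move=> /asboolP[n nE]; apply/asboolP; exists (- n) => i.
  by rewrite nE -addeA -EFinD rmorphN mulNr subrr adde0.
split.
- by move=> x; apply/asboolP; exists 0 => i; rewrite mul0r adde0.
- by move=> x y; apply/idP/idP; exact: sym.
- move=> y x z /asboolP[n nE] /asboolP[m mE]; apply/asboolP.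
  by exists (n + m) => i; rewrite mE nE -addeA -EFinD -mulrDl -rmorphD.
Qed.

Canonical orbit_equiv_rel := EquivRelPack orbit_equiv.

Definition hopf : Type := quotient_topology {eq_quot orbit_equiv_rel}%qT.

HB.instance Definition _ := Topological.on hopf.
HB.instance Definition _ := Quotient.on hopf.

Definition hopf_pi (x : X) : hopf := \pi_hopf%qT x.

Lemma hopf_piP x y : hopf_pi x = hopf_pi y <-> orbit_rel x y.
Proof. by split => [/eqmodP|xy]; last exact/eqmodP. Qed.

(* O_S^*: the finite-valued functions which lift to functions on T^d \ {oo} that
   are locally, boundary points included, integer affine. *)
Definition regular_unit (U : set hopf) : set (hopf -> R) :=
  [set f | forall x, U (hopf_pi x) -> exists c k,
    \forall y \near x, (f (hopf_pi y))%:E = iaff c k y].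

Program Definition unit_sheaf : fun_presheaf hopf R :=
  {| sections := regular_unit |}.
Next Obligation.
move=> U x _; exists 0, (fun=> 0); apply: filterE => y.
by rewrite /iaff /lin big1 ?adde0// => i _; rewrite mul0e.
Qed.
Next Obligation.
move=> U f g fU gU x Ux; have [c [k fE]] := fU x Ux.
have [c' [k' gE]] := gU x Ux; exists (c - c'), (fun i => k i - k' i).
near=> y; have fy : (f (hopf_pi y))%:E = iaff c k y by near: y.
have gy : (g (hopf_pi y))%:E = iaff c' k' y by near: y.
by rewrite EFinB fy gy iaffB -?fy -?gy.
Unshelve. all: by end_near.
Qed.
Next Obligation. by move=> U V f VU fU x /VU; exact: fU. Qed.

Definition Pic : zmodType := cechH1 unit_sheaf.

(* A codimension-one cycle, as the assignment of weights to its generic points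
   (interior points of facets, and points off the support with weight 0); a
   cycle has no weight at the points of its skeleton of codimension two. *)
Definition weights : Type := hopf -> set int.

(* The cycle Z is given by div(P_i - Q_i) in the charts V_i, and the cocycle c
   on the cover (hopf_pi @` V_i) is (P_i - Q_i) - (P_j - Q_j). *)
Definition local_equations (Z : weights) (c : cocycle unit_sheaf) : Prop :=
  exists (V : idx c -> set X) (P Q : idx c -> tpoly R d),
    [/\ forall i, [/\ open (V i), {in V i &, injective hopf_pi},
                      cov i = hopf_pi @` V i, P i != [::] & Q i != [::]],
        forall i x m, V i x ->
          Z (hopf_pi x) m <-> div_weight (trat (P i) (Q i)) x m &
        forall i j x y, V i x -> V j y -> finite_pt x ->
          hopf_pi x = hopf_pi y ->
          trans i j (hopf_pi x) = trat (P i) (Q i) x - trat (P j) (Q j) y].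

Definition has_section (L : Pic) : Prop :=
  exists (Z : weights) (c : cocycle unit_sheaf),
    local_equations Z c /\ cocycle_class c = L.

End Hopf.

(* Main.v *)
From HB Require Import structures.
Require Import Defs.
From mathcomp Require Import all_boot all_order all_algebra.
From mathcomp Require Import all_classical all_reals all_analysis.
From mathcomp Require Import zify ring lra.
Import Defs.
Set Implicit Arguments.
Unset Strict Implicit.
Unset Printing Implicit Defensive.
Import Order.TTheory GRing.Theory Num.Theory.
Local Open Scope classical_set_scope.
Local Open Scope ring_scope.

(** Write X for T^d minus its point at infinity, S = X / <F>, and O for the
    sheaf of locally integer affine functions.  The theorem says that every
    class in H^1(S, O) is a flat bundle, determined by its real holonomy along
    the loop x |-> x + a, and that flat bundles have explicit sections.

    The group O(X) consists of constants (global_cst): the slope is constant on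
    the finite part R^d of X, and its i-th component vanishes because X has
    points with x_i = oo, as d > 1.

    The group H^1(X, O) vanishes.  A cocycle is treated as a torsor under O,
    given by a predicate loc on germs of functions, and torsor_has_section finds
    a global section.  Over R^d a germ is a pair (c, k) in R x Z^d, so sections
    continue uniquely along segments; continuing a germ at 0 along all segments
    [0, v] gives a section over R^d (finite_section), unique up to an affine
    function.  A local section at a boundary point x differs from it by an
    affine function, whose slopes k_i along the infinite coordinates of x are
    determined by x (rel_slope_uniq).  Each k_i is locally constant on the facet
    x_i = oo, which is nonempty and connected as d > 1 (rel_slope_facet); so one
    affine function corrects the section over R^d at all boundary points at once
    (rel_slope_global).

    Hence the pullback to X of a cocycle on S has a section G, and
    G (x + a) - G x is in O(X), that is, a constant l: the cocycle is
    cohomologous to the flat one of holonomy l (flat_class_surj).  If two flat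
    cocycles of holonomies l and l' are cohomologous, the same computation gives
    a function in O(X) which increases by l' - l under the translation, whence
    l = l' (flat_class_inj).

    For a section of the flat bundle, it suffices to find a tropical rational
    function on a neighbourhood of a fundamental domain which is constant near
    both ends and whose two values differ by l.  The function
    min(0, K (x_i - 3/4 a_i)) - min(0, K (x_i - 3/4 a_i) - l), with K a large
    integer, is one: it only varies near the wall min_i x_i / a_i = 3/4. *)

(** * Neighbourhoods in the punctured tropical space *)

Section Germs.
Variables (R : realType) (d : nat).
Local Notation X := (set_type (@punctured R d)).
Implicit Types (x y z : X) (g h : X -> R).

(** Basic neighbourhoods of u in T, that is, among the w other than -oo: a ball
    when u is finite, and ]M, oo] when u = oo. *)
Definition tball (e M : R) (u w : \bar R) : Prop :=
  if u is r%:E then exists2 s, w = s%:E & `|s - r| < e else (M%:E < w)%E.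

Definition box (e M : R) x y : Prop :=
  forall i, tball e M (coord x i) (coord y i).

Lemma tball_nbhs (e M : R) (u : \bar R) : 0 < e -> u != -oo%E ->
  nbhs u (tball e M u).
Proof.
move=> e0; case: u => [r||//] _ /=.
  by exists e => //= s /= rs; exists s => //; rewrite distrC.
by exists M; split => //; exact: num_real.
Qed.

Lemma nbhs_tball (u : \bar R) (A : set (\bar R)) : u != -oo%E -> nbhs u A ->
  exists2 e, 0 < e & exists M, forall w, tball e M u w -> A w.
Proof.
case: u => [r||//] _.
  case=> e /= e0 eA; exists e => //; exists 0 => w [s -> rs].
  by apply: (eA s); rewrite /= distrC.
by case=> M [_ MA]; exists 1 => //; exists M.
Qed.

Lemma tballW e M e' M' u w : e <= e' -> M' <= M -> tball e M u w ->
  tball e' M' u w.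
Proof.
move=> ee MM; case: u => [r||] /=.
- by case=> s -> rs; exists s => //; exact: lt_le_trans ee.
- by apply: le_lt_trans; rewrite lee_fin.
- by apply: le_lt_trans; rewrite lee_fin.
Qed.

Lemma boxW e M e' M' x y : e <= e' -> M' <= M -> box e M x y -> box e' M' x y.
Proof. by move=> ee MM xy i; exact: tballW (xy i). Qed.

Lemma tcoord_continuous i : continuous (fun x => coord x i).
Proof.
move=> x; apply: (@continuous_comp _ _ _ (set_val : X -> {ptws 'I_d -> \bar R})
  (@proj _ _ i)).
  exact: initial_continuous.
exact: proj_continuous.
Qed.

Definition box_filter x : set_system X :=
  [set A | exists2 e, 0 < e & exists M, forall y, box e M x y -> A y].

Instance box_filter_filter x : Filter (box_filter x).
Proof.
split.
- by exists 1 => //; exists 0.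
- move=> A B [e e0 [M MA]] [f f0 [N NB]].
  exists (Num.min e f); first by rewrite lt_min e0 f0.
  exists (Num.max M N) => y xy; split.
    by apply: MA; apply: boxW xy; rewrite ?ge_min ?le_max lexx.
  by apply: NB; apply: boxW xy; rewrite ?ge_min ?le_max lexx orbT.
- by move=> A B AB [e e0 [M MA]]; exists e => //; exists M => y /MA/AB.
Qed.

(** The topology of X is initial for the coordinates, so convergence of the
    filter of boxes is checked one coordinate at a time. *)
Lemma box_filter_cvg x : nbhs x `<=` box_filter x.
Proof.
move=> N [_ [[B oB <-] Bx BN]].
suff : nbhs (set_val x : {ptws 'I_d -> \bar R}) `<=` set_val @ box_filter x.
  move=> /(_ B) []; first exact: open_nbhs_nbhs.
  by move=> e e0 [M MB]; exists e => //; exists M => y /MB /BN.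
have FF : Filter (set_val @ box_filter x : set_system {ptws 'I_d -> \bar R}).
  exact: fmap_filter.
apply: (proj2 (@cvg_sup _ _ _ _ _ FF)) => i A [_ [[C oC <-] Cx CA]].
have : nbhs (coord x i) C by exact: open_nbhs_nbhs.
move=> /(nbhs_tball (coord_ninfty x i)) [e e0 [M MC]].
by exists e => //; exists M => y xy; apply: CA; apply: (MC (coord y i)).
Qed.

(** Reduces all questions of topology on X to inequalities on coordinates. *)
Lemma near_boxP x (Q : X -> Prop) : (\forall y \near x, Q y) <->
  exists2 e, 0 < e & exists M, forall y, box e M x y -> Q y.
Proof.
split; first exact: (@box_filter_cvg x Q).
case=> e e0 [M MQ]; apply: (@filterS _ _ _ (box e M x)); first exact: MQ.
have H i : \forall y \near x, tball e M (coord x i) (coord y i).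
  by apply: (@tcoord_continuous i x); apply: tball_nbhs => //; exact: coord_ninfty.
exact: (filter_forall (nbhs_filter x) H).
Qed.

Lemma box_fin e M x y i (r : R) : coord x i = r%:E -> box e M x y ->
  exists2 s, coord y i = s%:E & `|s - r| < e.
Proof. by move=> xi /(_ i); rewrite /tball xi. Qed.

Lemma coordP x i : (exists r, coord x i = r%:E) \/ coord x i = +oo%E.
Proof.
have := coord_ninfty x i; case: (coord x i) => [r||] // _; last by right.
by left; exists r.
Qed.

Lemma coord_fine x i : coord x i != +oo%E -> coord x i = (fine (coord x i))%:E.
Proof. by case: (coordP x i) => [[r ->]|->]. Qed.

(** Points are parametrized by the set J of their infinite coordinates together
    with a real vector; for fixed J this is the open face of X of type J, and
    its affine structure is that of the vectors. *)
Definition pvec (J : pred 'I_d) (v : 'I_d -> R) : 'I_d -> \bar R :=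
  fun i => if J i then +oo%E else (v i)%:E.

Lemma pvec_punctured (J : pred 'I_d) v : (exists i, ~~ J i) ->
  pvec J v \in (punctured (R:=R) (d:=d)).
Proof.
move=> [i Ji]; apply/mem_set; split; first by move=> j; rewrite /pvec; case: ifP.
by exists i; rewrite /pvec (negbTE Ji).
Qed.

Definition pt (J : pred 'I_d) (hJ : exists i, ~~ J i) (v : 'I_d -> R) : X :=
  SigSub (pvec_punctured v hJ).

Lemma coord_pt J hJ v i :
  coord (@pt J hJ v) i = if J i then +oo%E else (v i)%:E.
Proof. by []. Qed.

Lemma coord_inj x y : (forall i, coord x i = coord y i) -> x = y.
Proof. by move=> xy; apply: val_inj; apply: funext. Qed.

Definition inftys x : pred 'I_d := fun i => coord x i == +oo%E.

Lemma inftysP x : exists i, ~~ inftys x i.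
Proof. by case: x => x xP /=; case/set_mem: (xP) => _ [i xi]; exists i. Qed.

Lemma pt_coord x : x = pt (inftysP x) (fun i => fine (coord x i)).
Proof.
apply: coord_inj => i; rewrite coord_pt /inftys.
by case: (coordP x i) => [[r ->]|->].
Qed.

Lemma near_pt J hJ v (Q : X -> Prop) : (\forall y \near @pt J hJ v, Q y) ->
  exists2 e, 0 < e & forall w, (forall i, `|w i - v i| < e) -> Q (pt hJ w).
Proof.
move=> /near_boxP [e e0 [M MQ]]; exists e => // w wv; apply: MQ => i.
rewrite !coord_pt /tball; case: ifP => _; first by rewrite ltry.
by exists (w i).
Qed.

(** * Germs of integer affine functions *)

(** As fine +oo = 0, infinite coordinates are ignored, so that this real-valued
    function agrees with the affine function wherever the latter is finite. *)
Definition affR (c : R) (k : 'I_d -> int) x : R :=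
  c + \sum_(i < d) (k i)%:~R * fine (coord x i).

Lemma iaffE c k x : iaff c k x \is a fin_num -> iaff c k x = (affR c k x)%:E.
Proof.
move=> fh; rewrite /iaff /affR EFinD -sumEFin; congr (_ + _)%E.
apply: eq_bigr => i _; have [->|xf] := iaff_term i fh.
  by rewrite mul0e mul0r.
by rewrite EFinM fineK.
Qed.

Lemma iaff_fin c k x : (forall i, coord x i = +oo%E -> k i = 0) ->
  iaff c k x \is a fin_num.
Proof.
move=> kx; rewrite fin_numD /= sum_fin_num; apply/allP => _ /mapP[i _ ->] /=.
case: (coordP x i) => [[r ->]|xi]; first by rewrite fin_numM.
by rewrite kx// mul0e.
Qed.

Lemma iaff_affR c k x : (forall i, coord x i = +oo%E -> k i = 0) ->
  iaff c k x = (affR c k x)%:E.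
Proof. by move=> /(iaff_fin c)/iaffE. Qed.

Lemma iaff_affR_fin c k x : finite_pt x -> iaff c k x = (affR c k x)%:E.
Proof. by move=> fx; apply: iaff_affR => i xi; move: (fx i); rewrite xi eqxx. Qed.

Lemma affRB c k c' k' x :
  affR c k x - affR c' k' x = affR (c - c') (fun i => k i - k' i) x.
Proof.
rewrite /affR opprD addrACA; congr (_ + _); rewrite -sumrB.
by apply: eq_bigr => i _; rewrite rmorphB mulrBl.
Qed.

Definition germ g x c k : Prop := \forall y \near x, (g y)%:E = iaff c k y.
Definition laff g x : Prop := exists c k, germ g x c k.
(** The germ of g on the finite part of X only: no condition on the slopes along
    the infinite coordinates of x, and g may be arbitrary on the boundary. *)
Definition fgerm g x c k : Prop :=
  \forall y \near x, finite_pt y -> g y = affR c k y.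

Lemma germ_fgerm g x c k : germ g x c k -> fgerm g x c k.
Proof.
apply: filterS => y + fy; rewrite iaff_affR_fin//; by case.
Qed.

Lemma germ_self g x c k : germ g x c k -> (g x)%:E = iaff c k x.
Proof. exact: nbhs_singleton. Qed.

(** An affine function involving an infinite coordinate has an infinite value,
    but g is real-valued. *)
Lemma germ_slope0 g x c k i : germ g x c k -> coord x i = +oo%E -> k i = 0.
Proof.
move=> /germ_self gx xi; have : iaff c k x \is a fin_num by rewrite -gx.
by move=> /(iaff_term i) []//; rewrite xi.
Qed.

Lemma near_fin x : \forall y \near x,
  forall i, coord x i != +oo%E -> coord y i != +oo%E.
Proof.
apply/near_boxP; exists 1 => //; exists 0 => y xy i.
by case: (coordP x i) => [[r xi]|-> //] _; have [s -> _] := box_fin xi xy.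
Qed.

Lemma germ_affR c k x : (forall i, coord x i = +oo%E -> k i = 0) ->
  germ (affR c k) x c k.
Proof.
move=> kx; have := near_fin x; apply: filterS => y xy.
rewrite iaff_affR// => i yi; apply: kx.
by case: (coordP x i) => // -[r xi]; move: (xy i); rewrite xi yi => /(_ isT).
Qed.

Lemma near_finite x : finite_pt x -> \forall y \near x, finite_pt y.
Proof.
by move=> fx; have := near_fin x; apply: filterS => y xy i; apply: xy; exact: fx.
Qed.

Lemma germB g h x c k c' k' : germ g x c k -> germ h x c' k' ->
  germ (fun y => g y - h y) x (c - c') (fun i => k i - k' i).
Proof.
move=> gx hx; near=> y.
have gy : (g y)%:E = iaff c k y by near: y.
have hy : (h y)%:E = iaff c' k' y by near: y.
by rewrite EFinB gy hy iaffB -?gy -?hy.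
Unshelve. all: by end_near.
Qed.

Lemma laffB g h x : laff g x -> laff h x -> laff (fun y => g y - h y) x.
Proof.
by move=> [c [k gx]] [c' [k' hx]]; do 2 eexists; exact: (germB gx hx).
Qed.

Lemma germ_cst c x : germ (fun=> c) x c (fun=> 0).
Proof.
apply: filterE => y; rewrite iaff_affR// /affR big1 ?addr0// => i _.
by rewrite mul0r.
Qed.

Lemma laff_cst c x : laff (fun=> c) x.
Proof. by exists c, (fun=> 0); exact: germ_cst. Qed.

Lemma laffN g x : laff g x -> laff (fun y => - g y) x.
Proof.
move=> /(laffB (laff_cst 0 x)); under eq_fun do rewrite sub0r; exact.
Qed.

Lemma laffD g h x : laff g x -> laff h x -> laff (fun y => g y + h y) x.
Proof.
by move=> gx /laffN /(laffB gx); under eq_fun do rewrite opprK.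
Qed.

Lemma germ_near g h x c k : (\forall y \near x, g y = h y) ->
  germ g x c k -> germ h x c k.
Proof.
by move=> gh gx; near=> y; rewrite -(near gh y)// (near gx y).
Unshelve. all: by end_near.
Qed.

Lemma laff_near g h x : (\forall y \near x, g y = h y) -> laff g x -> laff h x.
Proof. by move=> gh [c [k gx]]; exists c, k; exact: germ_near gx. Qed.

Lemma germ_open g x c k : germ g x c k -> \forall y \near x, germ g y c k.
Proof. by move=> /near_join. Qed.

Lemma laff_open g x : laff g x -> \forall y \near x, laff g y.
Proof.
by move=> [c [k /germ_open]]; apply: filterS => y gy; exists c, k.
Qed.

Lemma fgermB g h x c k c' k' : fgerm g x c k -> fgerm h x c' k' ->
  fgerm (fun y => g y - h y) x (c - c') (fun i => k i - k' i).
Proof.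
move=> gx hx; near=> y => fy; rewrite -affRB; congr (_ - _).
  by move: fy; near: y.
by move: fy; near: y.
Unshelve. all: by end_near.
Qed.

(** Any neighbourhood of x, even on the boundary, contains a cube of finite
    points, and an affine function on a cube determines its coefficients. *)
Lemma fgerm_inj g x c k c' k' : fgerm g x c k -> fgerm g x c' k' ->
  c = c' /\ k = k'.
Proof.
move=> gk gk'; have /near_boxP : \forall y \near x,
    finite_pt y -> affR c k y = affR c' k' y.
  near=> y => fy; rewrite -(near gk y) // -?(near gk' y)//.
move=> [e e0 [M MQ]].
have [i0 _] := inftysP x.
have h0 : exists i : 'I_d, ~~ pred0 i by exists i0.
(* The corner of a cube of side e of finite points of the box. *)
pose p i := if coord x i == +oo%E then M + 1 else fine (coord x i).
have key v : (forall i, p i <= v i < p i + e) ->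
    c + \sum_(i < d) (k i)%:~R * v i = c' + \sum_(i < d) (k' i)%:~R * v i.
  move=> pv; have := MQ (pt h0 v); rewrite /affR; apply => // i.
  have := pv i; rewrite coord_pt /= /tball /p.
  case: (coordP x i) => [[r ->]|->] /= /andP[p1 p2].
    by exists (v i) => //; rewrite ger0_norm; lra.
  by rewrite lte_fin; lra.
(* The slopes along e_j are compared at p and at p + (e/2) e_j. *)
have split_sum (m : 'I_d -> int) j :
    \sum_(i < d) (m i)%:~R * (p i + (if i == j then e / 2 else 0)) =
    \sum_(i < d) (m i)%:~R * p i + (m j)%:~R * (e / 2).
  under eq_bigr do rewrite mulrDr.
  rewrite big_split /=; congr (_ + _).
  rewrite (bigD1 j)//= eqxx big1 ?addr0// => i /negbTE ->.
  by rewrite mulr0.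
have kk : k = k'.
  apply: funext => j; pose q i := p i + (if i == j then e / 2 else 0).
  have pq i : p i <= q i < p i + e by rewrite /q; case: ifP => _; lra.
  have pp i : p i <= p i < p i + e by rewrite lexx ltrDl.
  have := key q pq; rewrite !split_sum; have := key p pp => E1 E2.
  have e20 : e / 2 != 0 by rewrite gt_eqF// divr_gt0.
  apply/eqP; rewrite -(eqr_int R) -(inj_eq (mulIf e20)); apply/eqP; lra.
split => //; have := key p; rewrite kk => /(_ _)/addIr; apply => i.
by rewrite lexx ltrDl.
Unshelve. all: by end_near.
Qed.

Lemma germ_inj g x c k c' k' : germ g x c k -> germ g x c' k' ->
  c = c' /\ k = k'.
Proof. by move=> /germ_fgerm gx /germ_fgerm; exact: fgerm_inj. Qed.

Lemma laff_fgerm g x c k : laff g x -> fgerm g x c k -> germ g x c k.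
Proof.
move=> [c' [k' gx]] gx'.
by have [<- <-] := fgerm_inj (germ_fgerm gx) gx'.
Qed.

End Germs.

(** * Continuation along segments *)

Section Cousin.
Variable R : realType.

(** Compactness of [a, b] in the form of Cousin's lemma: an additive property of
    intervals which holds locally holds globally.  The proof is a supremum
    argument on the t such that P a t. *)
Lemma cousin (P : R -> R -> Prop) (a b : R) : a <= b ->
  (forall x y z, x <= y <= z -> P x y -> P y z -> P x z) ->
  (forall t, a <= t <= b -> exists2 e, 0 < e &
    forall x y, a <= x <= t -> t <= y <= b -> t - e < x -> y < t + e -> P x y) ->
  P a b.
Proof.
move=> ab tr loc; pose A := [set t | a <= t <= b /\ P a t].
have Aa : A a.
  split; first by rewrite lexx ab.
  have [|e e0 He] := loc a; first by rewrite lexx ab.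
  by apply: He; rewrite ?lexx ?ab// ?ltrBlDr ltrDl.
have Aub : ubound A b by move=> t [/andP[_ ->]].
have supA : has_sup A by split; [exists a | exists b].
have as_ : a <= sup A by apply: ub_le_sup => //; exists b.
have sb : sup A <= b by apply: ge_sup => //; exists a.
have [|e e0 He] := loc (sup A); first by rewrite as_ sb.
have [t [/andP[a_t tb] Pat] tlt] := sup_adherent e0 supA.
have ts : t <= sup A by apply: ub_le_sup; [exists b | split; rewrite ?a_t].
have Pas : P a (sup A).
  apply: (tr _ t) Pat _; first by rewrite a_t.
  by apply: He => //; rewrite ?a_t ?lexx ?ts//; rewrite ltrDl.
case: (ltP (sup A) b) => [sltb|bs]; last first.
  by have <- : sup A = b by apply/eqP; rewrite eq_le sb bs.
pose y := Num.min b (sup A + e / 2).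
have sy : sup A < y by rewrite lt_min sltb ltrDl divr_gt0.
have yb : y <= b by rewrite ge_min lexx.
have : A y.
  split; first by rewrite yb (le_trans as_ (ltW sy)).
  apply: (tr _ (sup A)) Pas _; first by rewrite as_ ltW.
  apply: He; rewrite ?as_ ?lexx ?(ltW sy) ?yb//; first by rewrite ltrBlDr ltrDl.
  by rewrite /y gt_min ltrD2l gtr_pMr// ?invf_lt1 ?ltr1n ?orbT.
have ubA : has_ubound A by exists b.
by move=> /(ub_le_sup ubA); rewrite leNgt sy.
Qed.

Lemma locally_constant01 (Q : R -> Prop) :
  (forall t, 0 <= t <= 1 -> exists2 e, 0 < e &
    forall s, 0 <= s <= 1 -> `|s - t| < e -> Q s <-> Q t) ->
  Q 0 -> Q 1.
Proof.
move=> loc; apply: (@cousin (fun s t => Q s -> Q t)) => //.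
  by move=> x y z _ xy yz /xy.
move=> t t01; have [e e0 He] := loc t t01.
exists e => // x y /andP[x0 xt] /andP[ty y1] tx yt.
have {}tx : `|x - t| < e by rewrite ler0_norm ?subr_le0//; lra.
have {}yt : `|y - t| < e by rewrite ger0_norm ?subr_ge0//; lra.
have x1 : x <= 1 by exact: le_trans (le_trans xt ty) y1.
have y0 : 0 <= y by exact: le_trans (le_trans x0 xt) ty.
by move=> /(He x _ tx); rewrite x0 x1 => /(_ isT)/(He y _ yt); apply; rewrite y0.
Qed.

End Cousin.

Section Convex.
Variable R : realDomainType.
Implicit Types a b c t : R.

Lemma conv_max a b t : 0 <= t <= 1 -> a + t * (b - a) <= Num.max a b.
Proof.
case/andP=> t0 t1; rewrite le_max; case: (leP a b) => ab; apply/orP.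
  by right; rewrite -lerBrDl ler_piMl// subr_ge0.
by left; rewrite gerDl mulr_ge0_le0// subr_le0 ltW.
Qed.

Lemma conv_min a b t : 0 <= t <= 1 -> Num.min a b <= a + t * (b - a).
Proof.
case/andP=> t0 t1; rewrite ge_min; case: (leP a b) => ab; apply/orP.
  by left; rewrite lerDl mulr_ge0// subr_ge0.
by right; rewrite -lerBlDl -lerN2 -mulrN ler_piMl// ?opprB ?subr_ge0 ltW.
Qed.

Lemma conv_ball a b c e t : 0 <= t <= 1 -> `|a - c| < e -> `|b - c| < e ->
  `|a + t * (b - a) - c| < e.
Proof.
move=> t01; rewrite !ltr_norml => /andP[a1 a2] /andP[b1 b2]; apply/andP; split.
  rewrite ltrBrDr; apply: lt_le_trans (conv_min _ _ t01).
  by rewrite lt_min -!ltrBrDr a1.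
by rewrite ltrBlDr; apply: le_lt_trans (conv_max _ _ t01) _;
   rewrite gt_max -!ltrBlDr a2.
Qed.

End Convex.

Section Segments.
Variables (R : realType) (d : nat).
Local Notation X := (set_type (@punctured R d)).
Implicit Types (x y z : X) (g h : X -> R).

Definition seg (v w : 'I_d -> R) (t : R) : 'I_d -> R :=
  fun i => v i + t * (w i - v i).

Lemma seg0 v w : seg v w 0 = v.
Proof. by apply: funext => i; rewrite /seg mul0r addr0. Qed.

Lemma seg1 v w : seg v w 1 = w.
Proof. by apply: funext => i; rewrite /seg mul1r addrC subrK. Qed.

Lemma seg_small (v w : 'I_d -> R) (e : R) : 0 < e -> exists2 f, 0 < f &
  forall s t, `|s - t| < f -> forall i, `|seg v w s i - seg v w t i| < e.
Proof.
move=> e0; pose B := 1 + \sum_i `|w i - v i|.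
have B0 : 0 < B by rewrite ltr_pwDl// sumr_ge0.
exists (e / B); first by rewrite divr_gt0.
move=> s t st i; rewrite /seg opprD addrACA subrr add0r -mulrBl normrM.
have wB : `|w i - v i| < B.
  rewrite /B (bigD1 i)//= addrCA ltrDl ltr_pwDl//.
  by rewrite sumr_ge0.
apply: (@le_lt_trans _ _ (`|s - t| * B)).
  by rewrite ler_wpM2l// ltW.
by rewrite -ltr_pdivlMr.
Qed.

(** The path t |-> v + t (w - v) inside an open face of X is continuous. *)
Lemma near_seg J hJ v w t (Q : X -> Prop) :
  (\forall y \near @pt R d J hJ (seg v w t), Q y) ->
  exists2 e, 0 < e & forall s, `|s - t| < e -> Q (pt hJ (seg v w s)).
Proof.
move=> /near_pt[e e0 eQ]; have [f f0 fe] := seg_small v w e0.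
by exists f => // s st; apply: eQ => i; exact: fe.
Qed.

(** The coefficients of a locally affine function are locally constant along a
    segment, since a germ determines its coefficients. *)
Lemma germ_seg g J hJ v w c k :
  (forall t, 0 <= t <= 1 -> laff g (@pt R d J hJ (seg v w t))) ->
  germ g (pt hJ v) c k -> germ g (pt hJ w) c k.
Proof.
move=> gl gv; rewrite -(seg1 v w).
apply: (@locally_constant01 _ (fun t => germ g (pt hJ (seg v w t)) c k)).
  move=> t /gl[c' [k' gt]].
  have [e e0 He] := near_seg (germ_open gt).
  exists e => // s _ /He gs.
  by split => [/(germ_inj gs)|/(germ_inj gt)] [<- <-].
by rewrite seg0.
Qed.

Hypothesis hd : (1 < d)%N.

Lemma exists_ne (i : 'I_d) : exists j, j != i.
Proof.
have h0 : (0 < d)%N by exact: ltnW.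
case: (eqVneq i (Ordinal h0)) => [->|ni]; first by exists (Ordinal hd).
by exists (Ordinal h0); rewrite eq_sym.
Qed.

Lemma pred0P : exists i : 'I_d, ~~ pred0 i.
Proof. by exists (Ordinal (ltnW hd)). Qed.

Lemma pred1P (i : 'I_d) : exists j, ~~ pred1 i j.
Proof. by have [j ji] := exists_ne i; exists j. Qed.

Definition fpt (v : 'I_d -> R) : X := pt pred0P v.

Lemma coord_fpt v i : coord (fpt v) i = (v i)%:E.
Proof. by []. Qed.

Lemma fpt_finite v : finite_pt (fpt v).
Proof. by move=> i. Qed.

Lemma finite_fpt x : finite_pt x -> x = fpt (fun i => fine (coord x i)).
Proof. by move=> fx; apply: coord_inj => i; rewrite coord_fpt coord_fine. Qed.

(** Neighbourhoods of a boundary point meet the larger faces adjacent to it: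
    some of its infinite coordinates can be replaced by large real numbers. *)
Lemma near_pt_sub J J' hJ hJ' v (Q : X -> Prop) : {subset J' <= J} ->
  (\forall y \near @pt R d J hJ v, Q y) ->
  exists M : R, forall w, (forall i, if J i then M < w i else w i == v i) ->
  Q (@pt R d J' hJ' w).
Proof.
move=> sJ /near_boxP [e e0 [M MQ]]; exists M => w wv; apply: MQ => i.
rewrite !coord_pt /tball; have := wv i; have := sJ i; rewrite !unfold_in.
case: (J i) => [_ Mw|J'J /eqP ->]; first by case: ifP => _; rewrite ?ltry.
case: (J' i) J'J => [/(_ isT)//|_]; exists (v i) => //; by rewrite subrr normr0.
Qed.

(** The slope along e_i can be computed far away in the direction e_i, near a
    point of the facet x_i = oo, where it vanishes.  That facet is nonempty
    because another coordinate can stay finite. *)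
Lemma global_slope0 g x c k : (forall y, laff g y) -> finite_pt x ->
  germ g x c k -> k = fun=> 0.
Proof.
move=> gl /finite_fpt ->; move: (fun i => _) => v gv; apply: funext => i.
have [c' [k' gi]] := gl (pt (pred1P i) v).
have [|M HM] := near_pt_sub (J' := pred0) pred0P _ (germ_open gi).
  by [].
pose w j := if pred1 i j then M + 1 else v j.
have gw : germ g (fpt w) c' k'.
  by apply: HM => j; rewrite /w; case: (pred1 i j); rewrite ?ltrDl.
have gw' : germ g (fpt w) c k by apply: germ_seg gv.
have [_ ->] := germ_inj gw' gw.
by apply: germ_slope0 gi _; rewrite coord_pt /= eqxx.
Qed.

(** All slopes vanish at the finite points, which are joined by segments; and the
    germ at a boundary point is determined by the finite points near it. *)
Lemma global_cst g : (forall y, laff g y) -> exists c, forall x, g x = c.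
Proof.
move=> gl; have [c [k g0]] := gl (fpt (fun=> 0)).
have k0 := global_slope0 gl (@fpt_finite _) g0; rewrite k0 in g0.
have gf v : germ g (fpt v) c (fun=> 0) by exact: germ_seg g0.
have aff0 y : affR c (fun=> 0) y = c.
  by rewrite /affR big1 ?addr0// => i _; rewrite mul0r.
exists c => x; suff : germ g x c (fun=> 0).
  by move/germ_self; rewrite iaff_affR// => -[]; rewrite aff0.
apply: laff_fgerm => //; apply: filterE => y fy.
rewrite (finite_fpt fy).
by have := germ_self (gf (fun i => fine (coord y i))); rewrite iaff_affR// => -[].
Qed.

End Segments.

(** * Torsors under the sheaf of integer affine functions *)

Section Torsor.
Variables (R : realType) (d : nat).
Local Notation X := (set_type (@punctured R d)).
Implicit Types (x y z : X) (g h G H : X -> R) (v w : 'I_d -> R).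
Hypothesis hd : (1 < d)%N.
Local Notation fpt := (fpt hd).
Local Notation fc y := (fun i => fine (coord y i)).

Lemma near_fpt v (Q : X -> Prop) : (\forall y \near fpt v, Q y) <->
  exists2 e, 0 < e & forall w, (forall i, `|w i - v i| < e) -> Q (fpt w).
Proof.
split; first exact: near_pt.
case=> e e0 He; apply/near_boxP; exists e => //; exists 0 => y vy.
have fy : finite_pt y by move=> i; have [s -> _] := box_fin (coord_fpt hd v i) vy.
rewrite (finite_fpt hd fy); apply: He => i.
by have [s -> //] := box_fin (coord_fpt hd v i) vy.
Qed.

Definition convexv (A : ('I_d -> R) -> Prop) := forall v w, A v -> A w ->
  forall t, 0 <= t <= 1 -> A (seg v w t).
Definition openv (A : ('I_d -> R) -> Prop) := forall v, A v ->
  exists2 e, 0 < e & forall w, (forall i, `|w i - v i| < e) -> A w.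

(** A torsor under O, presented inside the functions on X: loc x G says that the
    germ of G at x is a section.  The axioms are local existence, the free and
    transitive action of the germs in O, and dependence on germs only. *)
Variable loc : X -> (X -> R) -> Prop.
Hypothesis loc_ex : forall x, exists G, \forall y \near x, loc y G.
Hypothesis locB : forall x G H, loc x G -> loc x H ->
  laff (fun y => G y - H y) x.
Hypothesis locD : forall x G g, loc x G -> laff g x ->
  loc x (fun y => G y + g y).
Hypothesis loc_near : forall x G H, (\forall y \near x, G y = H y) ->
  loc x G -> loc x H.

Lemma loc_open x G : loc x G -> \forall y \near x, loc y G.
Proof.
move=> lG; have [H lH] := loc_ex x.
have /laff_open lGH := locB lG (nbhs_singleton lH).
near=> y; have : loc y (fun z => H z + (G z - H z)).
  by apply: locD; near: y.
by under eq_fun do rewrite addrC subrK.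
Unshelve. all: by end_near.
Qed.

Definition section_over (A : ('I_d -> R) -> Prop) G := forall v, A v -> loc (fpt v) G.

Lemma fpt_fc w : (fun i => fine (coord (fpt w) i)) = w.
Proof. by apply: funext => i; rewrite coord_fpt. Qed.

Lemma laff_affR_fin c k v : laff (affR c k) (fpt v).
Proof. by exists c, k; exact: germ_affR. Qed.

(** On the convex set where both A and B hold, the difference of the sections is
    a single affine function; it extends to R^d, so H can be corrected to agree
    with G there. *)
Lemma glue (A B : ('I_d -> R) -> Prop) p G H : openv A -> openv B ->
  convexv A -> convexv B -> A p -> B p -> section_over A G -> section_over B H ->
  exists K, section_over (fun v => A v \/ B v) K.
Proof.
move=> oA oB cA cB Ap Bp sA sB.
have lGH v : A v -> B v -> laff (fun y => G y - H y) (fpt v).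
  by move=> Av Bv; apply: locB; [exact: sA | exact: sB].
have [c [k pck]] := lGH p Ap Bp.
have germAB v : A v -> B v -> germ (fun y => G y - H y) (fpt v) c k.
  move=> Av Bv; apply: germ_seg pck => t t01.
  by apply: lGH; [exact: cA | exact: cB].
pose H' y := H y + affR c k y.
have sB' : section_over B H' by move=> v Bv; apply: locD (laff_affR_fin _ _ _); exact: sB.
have GH' v : A v -> B v -> G (fpt v) = H' (fpt v).
  move=> Av Bv; have := germ_self (germAB v Av Bv).
  by rewrite iaff_affR// => -[] /eqP; rewrite subr_eq addrC => /eqP.
exists (fun y => if `[< A (fc y) >] then G y else H' y) => v.
have [Av _|nAv [//|Bv]] := pselect (A v).
  apply: loc_near (sA v Av); apply/near_fpt; have [e e0 He] := oA v Av.
  by exists e => // w /He Aw; rewrite fpt_fc asboolT.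
apply: loc_near (sB' v Bv); apply/near_fpt; have [e e0 He] := oB v Bv.
exists e => // w /He Bw; rewrite fpt_fc; case: asboolP => // Aw.
by rewrite GH'.
Qed.

Definition tube v (s t e : R) w : Prop :=
  exists2 r, s <= r <= t & forall i, `|w i - r * v i| < e.

Lemma tube_open v s t e : openv (tube v s t e).
Proof.
move=> w [r rst wr].
case: (pickP (@predT 'I_d)) => [i0 _|no]; last first.
  by exists 1 => // w' _; exists r => // i; have := no i.
pose f := \big[Num.min/e - `|w i0 - r * v i0|]_i (e - `|w i - r * v i|).
have fle i : f <= e - `|w i - r * v i|.
  by rewrite /f (bigD1 i)//= ge_min lexx.
exists f.
  by rewrite /f; elim/big_ind: _ => [|a b a0 b0|i _]; rewrite ?subr_gt0// lt_min a0.
move=> w' ww'; exists r => // i.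
have -> : w' i - r * v i = (w' i - w i) + (w i - r * v i) by rewrite addrA subrK.
apply: le_lt_trans (ler_normD _ _) _.
by rewrite -ltrBrDr; exact: lt_le_trans (ww' i) (fle i).
Qed.

Lemma tube_convex v s t e : convexv (tube v s t e).
Proof.
move=> w w' [r /andP[sr rt] wr] [r' /andP[sr' rt'] wr'] l /andP[l0 l1].
have l01 : 0 <= l <= 1 by rewrite l0.
exists (r + l * (r' - r)).
  rewrite (le_trans _ (conv_min _ _ l01)) ?le_min ?sr//.
  by rewrite (le_trans (conv_max _ _ l01))// ge_max rt.
move=> i; have := conv_ball (c := 0) l01; rewrite /seg.
have -> : w i + l * (w' i - w i) - (r + l * (r' - r)) * v i =
  (w i - r * v i) + l * ((w' i - r' * v i) - (w i - r * v i)) - 0 by ring.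
by apply; rewrite subr0.
Qed.

(** Two tubes along consecutive parts of [0, v] are convex and meet near their
    common end point, so that sections over tubes can be glued; local sections
    give short tubes. *)
Lemma tube_section v : exists2 e, 0 < e & exists G, section_over (tube v 0 1 e) G.
Proof.
pose P s t := exists2 e, 0 < e & exists G, section_over (tube v s t e) G.
apply: (@cousin _ P) => //.
- move=> x y z /andP[xy yz] [e e0 [G sG]] [f f0 [H sH]].
  pose m := Num.min e f.
  have me : m <= e by rewrite ge_min lexx.
  have mf : m <= f by rewrite ge_min lexx orbT.
  have m0 : 0 < m by rewrite lt_min e0.
  have [||||K sK] := @glue (tube v x y m) (tube v y z m)
      (fun i => y * v i) G H (@tube_open _ _ _ _) (@tube_open _ _ _ _)
      (@tube_convex _ _ _ _) (@tube_convex _ _ _ _).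
  + by exists y; rewrite ?lexx ?xy// => i; rewrite subrr normr0.
  + by exists y; rewrite ?lexx ?yz// => i; rewrite subrr normr0.
  + move=> w [r rxy wr]; apply: sG; exists r => // i.
    exact: lt_le_trans (wr i) me.
  + move=> w [r rxy wr]; apply: sH; exists r => // i.
    exact: lt_le_trans (wr i) mf.
  exists m => //; exists K => w [r /andP[xr rz] wr]; apply: sK.
  by case: (leP r y) => ry; [left|right]; exists r; rewrite // ?xr ?ry ?(ltW ry).
- move=> t _; have [G /near_fpt[e e0 He]] := loc_ex (fpt (seg (fun=> 0) v t)).
  have e20 : 0 < e / 2 by rewrite divr_gt0.
  have [f f0 Hf] := seg_small (fun=> 0) v e20.
  exists f => // x y /andP[_ xt] /andP[ty _] tx yt.
  exists (e / 2) => //; exists G => w [r /andP[xr ry] wr]; apply: He => i.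
  have rt : `|r - t| < f by rewrite ltr_norml; apply/andP; split; lra.
  have := Hf r t rt i; have := wr i; rewrite /seg !subr0 !add0r.
  have -> : w i - t * v i = (w i - r * v i) + (r * v i - t * v i).
    by rewrite addrA subrK.
  move=> h1 h2; apply: le_lt_trans (ler_normD _ _) _; lra.
Qed.

(** Sections over the tubes around [0, v], normalized by their germ at 0, are
    unique along [0, v].  The value at v of the section over the tube around
    [0, v] is a section near v: for w close to v, the segment [0, w] lies in the
    tube around [0, v], so that both tubes give the same value at w. *)
Lemma finite_section : exists G, forall v, loc (fpt v) G.
Proof.
have [G0 /nbhs_singleton lG0] := loc_ex (fpt (fun=> 0)).
have : forall v, exists G, (exists2 e, 0 < e & section_over (tube v 0 1 e) G) /\
    germ (fun y => G y - G0 y) (fpt (fun=> 0)) 0 (fun=> 0).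
  move=> v; have [e e0 [G sG]] := tube_section v.
  have l0 : loc (fpt (fun=> 0)) G.
    apply: sG; exists 0; rewrite ?lexx ?ler01// => i.
    by rewrite mul0r subr0 normr0.
  have [c [k ck]] := locB l0 lG0.
  exists (fun y => G y + (- affR c k y)); split.
    exists e => // w /sG lw; apply: locD => //; apply: laffN.
    exact: laff_affR_fin.
  have ck' : germ (affR c k) (fpt (fun=> 0)) c k by exact: germ_affR.
  have := germB ck ck'; rewrite subrr.
  under [X in germ _ _ _ X]eq_fun do rewrite subrr.
  by apply: germ_near; apply: filterE => y; rewrite addrAC.
move=> /choice[Gs HGs]; exists (fun y => Gs (fc y) y) => v.
have [[e e0 sv] gv] := HGs v.
apply: loc_near (sv v _); last first.
  by exists 1; rewrite ?lexx ?ler01// => i; rewrite mul1r subrr normr0.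
apply/near_fpt; exists e => // w wv; rewrite fpt_fc.
have [[f f0 sw] gw] := HGs w.
have lD : forall t, 0 <= t <= 1 ->
    laff (fun y => Gs v y - Gs w y) (fpt (seg (fun=> 0) w t)).
  move=> t t01; apply: locB; [apply: sv|apply: sw].
    exists t => // i; rewrite /seg add0r subr0 -mulrBr normrM.
    case/andP: t01 => t0 t1; rewrite ger0_norm//.
    by apply: le_lt_trans (wv i); rewrite ler_piMl.
  by exists t => // i; rewrite /seg add0r subr0 subrr normr0.
have g0 : germ (fun y => Gs v y - Gs w y) (fpt (fun=> 0)) 0 (fun=> 0).
  have := germB gv gw; rewrite subrr.
  under [X in germ _ _ _ X]eq_fun do rewrite subrr.
  by apply: germ_near; apply: filterE => y; rewrite opprB addrA subrK.
have := germ_self (germ_seg lD g0); rewrite iaff_affR// /affR big1 ?addr0.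
  by move=> [] /eqP; rewrite subr_eq0 => /eqP.
by move=> i _; rewrite mul0r.
Qed.

(** * Extension to the boundary *)

Section Boundary.
Variable G0 : X -> R.
Hypothesis lG0 : forall v, loc (fpt v) G0.

(** In other words, up to a constant, the function G0 + <k, y> of the finite
    points y extends near x to a section. *)
Definition rel_slope x (k : 'I_d -> int) : Prop := exists G c,
  loc x G /\ fgerm (fun y => G y - G0 y) x c k.

(** A box around x has convex finite part, so the difference with G0 of a local
    section is a single affine function there. *)
Lemma rel_slope_ex x : exists k, rel_slope x k.
Proof.
have [G lG] := loc_ex x; have /near_boxP[e e0 [M HM]] := lG.
pose p i := if coord x i == +oo%E then M + 1 else fine (coord x i).
have boxp v : (forall i, tball e M (coord x i) (v i)%:E) -> box e M x (fpt v).
  by move=> h i; rewrite coord_fpt.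
have xp i : tball e M (coord x i) (p i)%:E.
  rewrite /p; case: (coordP x i) => [[r ->]|->] /=.
    by exists r => //; rewrite subrr normr0.
  by rewrite lte_fin ltrDl.
have [c [k ck]] := locB (HM _ (boxp _ xp)) (lG0 p).
exists k, G, c; split; first exact: (nbhs_singleton lG).
apply/near_boxP; exists e => //; exists M => y xy fy.
rewrite (finite_fpt hd fy); set v := fun i => _.
have xv i : tball e M (coord x i) (v i)%:E.
  by have := xy i; rewrite /v -coord_fine//; exact: fy.
suff /germ_self : germ (fun y => G y - G0 y) (fpt v) c k.
  by rewrite iaff_affR// => -[].
apply: germ_seg ck => t t01; apply: locB; last exact: lG0.
apply: HM; apply: (boxp (seg p v t)) => i.
have := xp i; have := xv i; rewrite /seg; case: (coordP x i) => [[r ->]|->] /=.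
  case=> _ [<-] vr [_ [<-] pr]; eexists; first by [].
  exact: conv_ball.
rewrite !lte_fin => Mv Mp; apply: lt_le_trans (conv_min _ _ t01).
by rewrite lt_min Mv Mp.
Qed.

(** Two local sections differ by a germ in O, whose slopes along the infinite
    coordinates vanish. *)
Lemma rel_slope_uniq x k k' i : rel_slope x k -> rel_slope x k' ->
  coord x i = +oo%E -> k i = k' i.
Proof.
move=> [G [c [lG ck]]] [H [e [lH ek]]] xi.
have [b [m bm]] := locB lG lH.
have : fgerm (fun y => G y - H y) x (c - e) (fun i => k i - k' i).
  have := fgermB ck ek; apply: filterS => y + fy => <- //.
  by rewrite opprB addrA subrK.
move=> /(fgerm_inj (germ_fgerm bm))[_ mE].
have := germ_slope0 bm xi; rewrite mE => /eqP.
by rewrite subr_eq0 => /eqP.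
Qed.

(** A function which does not involve the infinite coordinates of x is in O
    near x, so it can be added to a local section. *)
Lemma rel_slope_change x k k' : rel_slope x k ->
  (forall i, coord x i = +oo%E -> k i = k' i) -> rel_slope x k'.
Proof.
move=> [G [c [lG ck]]] kk'; pose m i := k i - k' i.
have gm : germ (affR 0 m) x 0 m.
  by apply: germ_affR => i /kk'; rewrite /m => ->; rewrite subrr.
exists (fun y => G y + - affR 0 m y), c; split.
  by apply: locD lG _; apply: laffN; exists 0, m.
have := fgermB ck (germ_fgerm gm); rewrite subr0.
have -> : (fun i => k i - m i) = k'.
  by apply: funext => i; rewrite /m opprB addrC subrK.
by apply: filterS => y + fy => <- //; rewrite addrAC.
Qed.

Lemma rel_slope_open x k : rel_slope x k -> \forall y \near x, rel_slope y k.
Proof.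
move=> [G [c [/loc_open lG /near_join ck]]].
by near=> y; exists G, c; split; near: y.
Unshelve. all: by end_near.
Qed.

(** The i-th slope is locally constant on the facet x_i = oo.  To reach the point
    of that facet whose other coordinates vanish, first make the other infinite
    coordinates of x finite, then follow a segment inside the open facet. *)
Lemma rel_slope_facet x k k' i : coord x i = +oo%E -> rel_slope x k ->
  rel_slope (pt (pred1P hd i) (fun=> 0)) k' -> k i = k' i.
Proof.
move=> xi /rel_slope_open xk.
have : \forall y \near pt (inftysP x) (fc x), rel_slope y k by rewrite -pt_coord.
move=> /(near_pt_sub (J' := pred1 i) (pred1P hd i)) [].
  by move=> j; rewrite !unfold_in => /eqP ->; rewrite xi eqxx.
move=> M HM.
pose w j := if inftys x j then M + 1 else fine (coord x j).
have {HM} : rel_slope (pt (pred1P hd i) w) k.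
  by apply: HM => j; rewrite /w; case: (inftys x j); rewrite ?ltrDl.
move=> kw k0.
suff [h hk <-] : exists2 h, rel_slope (pt (pred1P hd i) (fun=> 0)) h & h i = k i.
  by apply: rel_slope_uniq hk k0 _; rewrite coord_pt /= eqxx.
rewrite -(seg1 w (fun=> 0)).
apply: (@locally_constant01 _ (fun t => exists2 h,
  rel_slope (pt (pred1P hd i) (seg w (fun=> 0) t)) h & h i = k i)); last first.
  by exists k; rewrite ?seg0.
move=> t _; have [h ht] := rel_slope_ex (pt (pred1P hd i) (seg w (fun=> 0) t)).
have [e e0 He] := near_seg (rel_slope_open ht).
exists e => // s _ /He hs.
have infi u : coord (pt (pred1P hd i) u) i = +oo%E by rewrite coord_pt /= eqxx.
split=> -[l lh <-].
  by exists h => //; apply: rel_slope_uniq hs lh _.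
by exists h => //; apply: rel_slope_uniq ht lh _.
Qed.

Lemma rel_slope_global : exists k, forall x, rel_slope x k.
Proof.
have /choice[K HK] : forall i : 'I_d, exists k,
  rel_slope (pt (pred1P hd i) (fun=> 0)) k by move=> i; exact: rel_slope_ex.
exists (fun i => K i i) => x; have [k xk] := rel_slope_ex x.
by apply: (rel_slope_change xk) => i xi; exact: rel_slope_facet xi xk (HK i).
Qed.

End Boundary.

(** The vanishing of H^1(X, O).  By the choice of k, the function G0 + <k, x> on
    finite points extends at each x to a section; the extension is unique, as a
    germ in O vanishing on finite points vanishes, so the values at the points x
    of these extensions fit together. *)
Theorem torsor_has_section : exists G, forall x, loc x G.
Proof.
have [G0 lG0] := finite_section; have [k kx] := rel_slope_global lG0.
pose ext x H := loc x H /\ fgerm (fun y => H y - G0 y) x 0 k.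
have : forall x, exists H, ext x H.
  move=> x; have [G [c [lG ck]]] := kx x.
  exists (fun y => G y + - c); split.
    by apply: locD lG _; exact: laff_cst.
  have := fgermB ck (germ_fgerm (germ_cst c x)); rewrite subrr.
  under [X in fgerm _ _ _ X]eq_fun do rewrite subr0.
  by apply: filterS => y + fy => <- //; rewrite addrAC.
move=> /choice[Hs HHs]; exists (fun x => Hs x x) => x.
have [lH eH] := HHs x; apply: loc_near lH.
have lH' := loc_open (HHs x).1; move/near_join in eH.
near=> y; have ly : loc y (Hs x) by near: y.
have ey : fgerm (fun y => Hs x y - G0 y) y 0 k by near: y.
have [ly' ey'] := HHs y.
suff /germ_self : germ (fun z => Hs x z - Hs y z) y 0 (fun=> 0).
  rewrite iaff_affR// /affR big1 ?addr0.
    by move=> [] /eqP; rewrite subr_eq0 => /eqP.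
  by move=> i _; rewrite mul0r.
apply: laff_fgerm; first exact: locB.
have := fgermB ey ey'; rewrite subrr.
under [X in fgerm _ _ _ X]eq_fun do rewrite subrr.
by apply: filterS => z + fz => <- //; rewrite opprB addrA subrK.
Unshelve. all: by end_near.
Qed.

End Torsor.

(** * The translation and its fundamental domains *)

Section Translation.
Variables (R : realType) (d : nat) (a : 'I_d -> R).
Local Notation X := (set_type (@punctured R d)).
Implicit Types (x y z : X) (g h : X -> R) (n m : int).
Local Notation pi := (@hopf_pi R d a).

Definition translate n x : X :=
  pt (inftysP x) (fun i => fine (coord x i) + n%:~R * a i).

Lemma coord_translate n x i :
  coord (translate n x) i = (coord x i + (n%:~R * a i)%:E)%E.
Proof.
rewrite coord_pt /inftys; case: (coordP x i) => [[r ->]|->] //=.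
Qed.

Lemma pi_translate n x : pi (translate n x) = pi x.
Proof.
apply/esym/hopf_piP/asboolP; exists n => i; exact: coord_translate.
Qed.

Lemma pi_eq x y : pi x = pi y -> exists n, y = translate n x.
Proof.
move=> /hopf_piP/asboolP[n nE]; exists n; apply: (@coord_inj R d) => i.
by rewrite nE coord_translate.
Qed.

Lemma translateD n m x : translate n (translate m x) = translate (n + m) x.
Proof.
apply: (@coord_inj R d) => i; rewrite !coord_translate -addeA -EFinD -mulrDl -rmorphD.
by rewrite (addrC m).
Qed.

Lemma translate0 x : translate 0 x = x.
Proof. by apply: (@coord_inj R d) => i; rewrite coord_translate mul0r adde0. Qed.

Lemma translate_pinfty n x i : (coord (translate n x) i == +oo%E) = (coord x i == +oo%E).
Proof. by rewrite coord_translate; case: (coordP x i) => [[r ->]|->]. Qed.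

Lemma translate_finite n x : finite_pt x -> finite_pt (translate n x).
Proof. by move=> fx i; rewrite translate_pinfty. Qed.

Lemma near_translate n x (Q : X -> Prop) : (\forall y \near translate n x, Q y) ->
  \forall y \near x, Q (translate n y).
Proof.
move=> /near_boxP[e e0 [M MQ]]; apply/near_boxP; exists e => //.
exists (M + \sum_i `|n%:~R * a i|) => y xy; apply: MQ => i.
have := xy i; rewrite !coord_translate /tball.
have nM : - (n%:~R * a i) <= \sum_i `|n%:~R * a i|.
  rewrite (bigD1 i)//= -normrN (le_trans (ler_norm _))// lerDl.
  by rewrite sumr_ge0.
case: (coordP x i) => [[r ->]|->] /=.
  move=> [s -> sr]; exists (s + n%:~R * a i) => //.
  by rewrite opprD addrACA subrr addr0.
case: (coordP y i) => [[s ->]|-> _]; last by rewrite ltry.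
by rewrite -EFinD !lte_fin; lra.
Qed.

Definition translate_const n (k : 'I_d -> int) : R :=
  \sum_(i < d) (k i)%:~R * (n%:~R * a i).

Lemma lin_translate n k x : lin k (translate n x) = (lin k x + (translate_const n k)%:E)%E.
Proof.
rewrite /lin /translate_const -sumEFin -big_split /=; apply: eq_bigr => i _.
by rewrite coord_translate muleDr// fin_num_adde_defl.
Qed.

Lemma iaff_translate n c k x :
  iaff c k (translate n x) = iaff (c + translate_const n k) k x.
Proof. by rewrite /iaff lin_translate EFinD [(lin _ _ + _)%E]addeC addeA. Qed.

Lemma laff_translate n g x : laff g (translate n x) -> laff (fun y => g (translate n y)) x.
Proof.
move=> [c [k /near_translate gx]]; exists (c + translate_const n k), k.
by apply: filterS gx => y ->; rewrite iaff_translate.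
Qed.

(** The preimage in X of the image of V is the union of the translates of V. *)
Lemma open_pi (V : set X) : open V -> open (pi @` V).
Proof.
move=> oV; rewrite /open /= /quotient_topology.quotient_open.
suff -> : \pi_(hopf a)%qT @^-1` (pi @` V) = \bigcup_n [set x | V (translate n x)].
  apply: bigcup_open => n _; rewrite openE => x /= Vx.
  by apply: near_translate; rewrite -/(nbhs _ V); apply: open_nbhs_nbhs.
apply/seteqP; split => x /=.
  move=> [y Vy yx]; have [n xE] := pi_eq (esym yx : pi x = pi y).
  by exists n => //=; rewrite -xE.
by move=> [n _ /= Vx]; exists (translate n x) => //; exact: pi_translate.
Qed.

Lemma open_pre (U : set (hopf a)) x : open U -> U (pi x) ->
  \forall y \near x, U (pi y).
Proof.
move=> oU Ux; have : nbhs x (\pi_(hopf a)%qT @^-1` U).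
  by apply: open_nbhs_nbhs; split.
exact.
Qed.

Lemma repr_translate y : exists n, repr (pi y) = translate n y.
Proof. by apply: pi_eq; rewrite /hopf_pi reprK. Qed.

Hypothesis ha : forall i, 0 < a i.

(** The height min_i x_i / a_i is finite on X, also on the boundary, and grows by
    1 under the translation; it identifies X with a product of R with the space
    of orbits of the flow x + t a. *)
Definition is_height x (m : R) : Prop :=
  (forall i, ((m * a i)%:E <= coord x i)%E) /\
  exists i, coord x i = (m * a i)%:E.

Lemma height_ex x : exists r, is_height x r.
Proof.
have [i0 hi0] := inftysP x.
pose F i := fine (coord x i) / a i.
have := Order.TotalTheory.arg_minP F (hi0 : (fun i => ~~ inftys x i) i0).
case=> i xi Fi; exists (F i); split => [j|]; last first.
  by exists i; rewrite /F divfK ?gt_eqF//; exact: coord_fine.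
case: (coordP x j) => [[r xj]|->]; last by rewrite leey.
have := Fi j; rewrite /inftys xj => /(_ isT).
by rewrite lee_fin /(F j) xj /= ler_pdivlMr.
Qed.

Lemma height_uniq x (m m' : R) : is_height x m -> is_height x m' -> m = m'.
Proof.
move=> [le1 [i xi]] [le2 [j xj]]; apply/eqP; rewrite eq_le.
have := le1 j; have := le2 i; rewrite xi xj !lee_fin !ler_pM2r//.
by move=> -> ->.
Qed.

Definition height x : R := sval (cid (height_ex x)).

Lemma heightP x : is_height x (height x).
Proof. exact: svalP. Qed.

Lemma heightE x (m : R) : is_height x m -> height x = m.
Proof. exact: height_uniq (heightP x). Qed.

Lemma height_translate n x : height (translate n x) = height x + n%:~R.
Proof.
apply: heightE; have [le1 [i xi]] := heightP x; split=> [j|].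
  by rewrite coord_translate mulrDl EFinD leeD2r.
by exists i; rewrite coord_translate xi mulrDl.
Qed.

Lemma lt_height r x :
  (forall i, ((r * a i)%:E < coord x i)%E) <-> r < height x.
Proof.
have [le1 [i xi]] := heightP x; split.
  by move=> /(_ i); rewrite xi lte_fin ltr_pM2r.
move=> rx j; apply: lt_le_trans (le1 j).
by rewrite lte_fin ltr_pM2r.
Qed.

Lemma height_lt r x :
  (exists i, (coord x i < (r * a i)%:E)%E) <-> height x < r.
Proof.
have [le1 [i xi]] := heightP x; split.
  move=> [j xj]; have := le_lt_trans (le1 j) xj.
  by rewrite lte_fin ltr_pM2r.
by move=> xr; exists i; rewrite xi lte_fin ltr_pM2r.
Qed.

Lemma near_height (r r' : R) x : r < height x < r' ->
  \forall y \near x, r < height y < r'.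
Proof.
move=> /andP[rx xr'].
have H1 i : \forall y \near x, ((r * a i)%:E < coord y i)%E.
  have /lt_height/(_ i) xi := rx; exact: (@tcoord_continuous R d i x _ (open_ereal_gt' xi)).
have /height_lt[i xi] := xr'.
have H2 : \forall y \near x, (coord y i < (r' * a i)%:E)%E.
  exact: (@tcoord_continuous R d i x _ (open_ereal_lt' xi)).
have {}H1 : \forall y \near x, forall i, ((r * a i)%:E < coord y i)%E.
  exact: (filter_forall (nbhs_filter x) H1).
near=> y; apply/andP; split.
  by apply/lt_height; near: y.
by apply/height_lt; exists i; near: y.
Unshelve. all: by end_near.
Qed.

End Translation.

(** * Flat line bundles *)

Section Flat.
Variables (R : realType) (d : nat) (a : 'I_d -> R).
Hypothesis ha : forall i, 0 < a i.
Local Notation X := (set_type (@punctured R d)).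
Implicit Types (x y z : X) (g h : X -> R) (n m : int) (i j : bool).
Local Notation pi := (@hopf_pi R d a).
Local Notation height := (height ha).
Local Notation translate := (translate a).

(** The heights in ]0, 1[ form an open fundamental domain up to its boundary, and
    so do those in ]1/2, 3/2[, whose translates contain the boundary of the
    former. *)
Definition start i : R := if i then 1 / 2 else 0.

Definition chart i : set X := [set x | start i < height x < start i + 1].

(** The n such that the translate of x by - n a lies in the chart, when there is
    one. *)
Definition turns i x : int := Num.floor (height x - start i).

Lemma turns_translate i n x : turns i (translate n x) = turns i x + n.
Proof.
rewrite /turns height_translate addrAC floorDrz ?intr_int//.
by rewrite intrKfloor.
Qed.

Lemma turns_chart i x : chart i x -> turns i x = 0.
Proof.
move=> /andP[x1 x2]; apply: floor_def; rewrite add0r.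
by rewrite subr_ge0 ltW//= ltrBlDl.
Qed.

Lemma chart_open i : open (chart i).
Proof. by rewrite openE => x /= /near_height; apply: filterS. Qed.

Lemma chart_inj i : {in chart i &, injective pi}.
Proof.
move=> x y /set_mem xi /set_mem yi /pi_eq[n yE]; move: yi; rewrite yE => yi.
have := turns_chart yi; rewrite turns_translate (turns_chart xi) add0r => ->.
by rewrite translate0.
Qed.

(** The height of a lift of a point of the chart avoids the integers shifted by
    start i, which are the discontinuities of turns. *)
Lemma turns_near i x : (pi @` chart i) (pi x) ->
  \forall y \near x, turns i y = turns i x.
Proof.
move=> [z zi /pi_eq[n ->]]; rewrite turns_translate (turns_chart zi) add0r.
move: zi => /= /andP[z1 z2].
have /near_height : start i + n%:~R < height (translate n z) < start i + n%:~R + 1.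
  by rewrite height_translate addrAC !ltrD2r z1.
apply: filterS => y /andP[y1 y2]; apply: floor_def.
by rewrite rmorphD /= lerBrDl ltrBlDl ltW//= addrA.
Qed.

(** Only the points of integer height are outside the orbits of the first
    chart. *)
Lemma chart_cover (s : hopf a) : exists i, (pi @` chart i) s.
Proof.
have := reprK s; set x := repr s => xs.
pose n := Num.floor (height x).
have /andP[n1 n2] := floor_itv (height x).
rewrite rmorphD /= -/n in n1 n2.
have px : pi (translate (- n) x) = s by rewrite pi_translate.
have hx : height (translate (- n) x) = height x - n%:~R.
  by rewrite height_translate rmorphN.
case: (eqVneq (height x) n%:~R) => [hn|hn].
  exists true; exists (translate (- n + 1) x); last by rewrite pi_translate.
  by rewrite /chart /= height_translate rmorphD rmorphN /= hn /start; lra.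
exists false; exists (translate (- n) x) => //.
rewrite /chart /= hx /start subr_gt0 lt_neqAle eq_sym hn n1 /= add0r.
by rewrite ltrBlDl.
Qed.

(** The cocycle of the functions on X which increase by l under the translation:
    over the chart i, such a function is trivialized by subtracting
    l * turns i. *)
Definition flat_trans (l : R) i j (s : hopf a) : R :=
  l * (turns i (repr s) - turns j (repr s))%:~R.

Lemma flat_transE l i j x :
  flat_trans l i j (pi x) = l * (turns i x - turns j x)%:~R.
Proof.
rewrite /flat_trans; have [n ->] := repr_translate a x; rewrite !turns_translate.
by congr (_ * _%:~R); rewrite opprD addrACA subrr addr0.
Qed.

Local Obligation Tactic := idtac.
Program Definition flat (l : R) : cocycle (unit_sheaf a) := {|
  idx := bool; cov := fun i => pi @` chart i; trans := flat_trans l |}.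
Next Obligation. by move=> l i; apply: open_pi; exact: chart_open. Qed.
Next Obligation. by move=> l; exact: chart_cover. Qed.
Next Obligation.
move=> l i j x [/turns_near xi /turns_near xj].
apply: (@laff_near R d (fun=> flat_trans l i j (pi x))); last exact: laff_cst.
near=> y; rewrite !flat_transE; congr (_ * (_ - _)%:~R); symmetry; by near: y.
Unshelve. all: by end_near.
Qed.
Next Obligation.
move=> l i j k s _ _ _; rewrite /flat_trans -mulrDr -rmorphD.
by rewrite addrA subrK.
Qed.

Definition flat_class l : Pic a := cocycle_class (flat l).

Lemma flat_classD l l' : flat_class (l + l') = flat_class l + flat_class l'.
Proof.
transitivity (cocycle_class (cocycleD (flat l) (flat l'))); last first.
  by rewrite -cocycle_classD.
apply/cocycle_classP.
apply: (@coh_refine0 _ _ _ (flat (l + l')) (cocycleD (flat l) (flat l'))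
  (fun i => (i, i))) => [i s si|i j s _ _]; first by split.
by rewrite /= /flat_trans mulrDl.
Qed.

Lemma unit_laff (U : set (hopf a)) f x : unit_sheaf a U f -> U (pi x) ->
  laff (fun y => f (pi y)) x.
Proof. by move=> h /h. Qed.

Hypothesis hd : (1 < d)%N.

Lemma turns_laff i x (l : R) : (pi @` chart i) (pi x) ->
  laff (fun y => l * (turns i y)%:~R) x.
Proof.
move=> /turns_near xi.
apply: (@laff_near R d (fun=> l * (turns i x)%:~R)); last exact: laff_cst.
by apply: filterS xi => y ->.
Qed.

(** A coboundary relating the two cocycles gives functions f k such that
    f k - l * turns + l' * turns does not depend on k.  They form a global
    section of O on X, hence a constant; but it grows by l' - l under the
    translation. *)
Lemma flat_class_inj : injective flat_class.
Proof.
move=> l l' /cocycle_classP[K [W [r [t [f [Wo Wc Wr Of fE]]]]]].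
have [kk kkW] := choice Wc.
pose F k y := f k (pi y) - l * (turns (r k) y)%:~R + l' * (turns (t k) y)%:~R.
have FE k k' y : W k (pi y) -> W k' (pi y) -> F k y = F k' y.
  move=> ky ky'; have := fE k k' (pi y) ky ky'.
  rewrite /= !flat_transE /F !rmorphB /= => E.
  by apply/eqP; rewrite -subr_eq0; apply/eqP; move: E; lra.
pose g y := F (kk (pi y)) y.
have gl x : laff g x.
  have Wx := kkW (pi x).
  apply: (@laff_near R d (F (kk (pi x)))).
    have := open_pre (Wo (kk (pi x))) Wx; apply: filterS => y Wy.
    exact: FE.
  have [Wc1 Wc2] := Wr (kk (pi x)).
  apply: laffD; last by apply: turns_laff; exact: Wc2.
  apply: laffB; last by apply: turns_laff; exact: Wc1.
  exact: unit_laff (Of _) Wx.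
have [c gc] := global_cst hd gl.
have := gc (translate 1 (fpt hd (fun=> 0))); rewrite -(gc (fpt hd (fun=> 0))).
rewrite /g pi_translate /F !turns_translate pi_translate !rmorphD /=; lra.
Qed.

(** The pullback of the cocycle to X is a torsor, with sections the functions G
    for which the F k = G + trans k (io _) are in O: here io chooses, on S, an
    element of the cover containing each point.  A global section grows by a
    constant l under the translation, so that F k - l * turns i descends to S
    and is the required coboundary. *)
Lemma flat_class_surj (L : Pic a) : exists l, L = flat_class l.
Proof.
rewrite -[L]cocycle_class_repr; move: (repr L) => {L} c.
have [io Hio] := choice (@cov_full _ _ _ c).
have laff_trans k k' x : cov k (pi x) -> cov k' (pi x) ->
    laff (fun y => trans (c := c) k k' (pi y)) x.
  by move=> kx kx'; exact: unit_laff (trans_sec _ _) (conj kx kx').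
have near_cov (k : idx c) x : cov k (pi x) -> \forall y \near x, cov k (pi y).
  by apply: open_pre; exact: cov_open.
pose loc x (G : X -> R) := forall k, cov k (pi x) ->
  laff (fun y => G y + trans (c := c) k (io (pi y)) (pi y)) x.
have loc_near x (G H : X -> R) : (\forall y \near x, G y = H y) ->
    loc x G -> loc x H.
  move=> GH lG k kx; apply: laff_near (lG k kx).
  by apply: filterS GH => y ->.
have locB x (G H : X -> R) : loc x G -> loc x H ->
    laff (fun y => G y - H y) x.
  move=> lG lH; apply: laff_near (laffB (lG _ (Hio (pi x))) (lH _ (Hio (pi x)))).
  by apply: filterE => y; rewrite opprD addrACA subrr addr0.
have locD x (G g : X -> R) : loc x G -> laff g x ->
    loc x (fun y => G y + g y).
  move=> lG gx k kx; apply: laff_near (laffD (lG k kx) gx).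
  by apply: filterE => y; rewrite addrAC.
have loc_ex x : exists G, \forall y \near x, loc y G.
  pose k0 := io (pi x).
  exists (fun y => trans (c := c) (io (pi y)) k0 (pi y)).
  have := near_cov k0 x (Hio _); apply: filterS => y k0y k ky.
  apply: laff_near (laff_trans k k0 y ky k0y).
  near=> z.
  have kz : cov k (pi z) by near: z; exact: near_cov.
  have k0z : cov k0 (pi z) by near: z; exact: near_cov.
  by rewrite addrC (transD kz (Hio _) k0z).
have [G lG] := torsor_has_section hd loc_ex locB locD loc_near.
have lG1 x : loc x (fun y => G (translate 1 y)).
  move=> k kx; have kx' : cov k (pi (translate 1 x)) by rewrite pi_translate.
  apply: laff_near (laff_translate (lG _ k kx')).
  by apply: filterE => y; rewrite pi_translate.
have [l Gl] := global_cst hd (fun x => locB _ _ _ (lG1 x) (lG x)).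
have Gn n x : G (translate n x) = G x + l * n%:~R.
  elim: n => [|n IHn|n IHn]; first by rewrite translate0 mulr0 addr0.
    have := Gl (translate n x); rewrite translateD => /eqP.
    by rewrite subr_eq => /eqP ->; rewrite IHn intS rmorphD /=; lra.
  have := Gl (translate (- n.+1%:Z) x); rewrite translateD.
  have -> : 1 + - n.+1%:Z = - n%:Z by rewrite intS; lra.
  rewrite IHn intS !rmorphN /= rmorphD /=; lra.
exists l; apply/cocycle_classP.
pose F k y := G y + trans (c := c) k (io (pi y)) (pi y).
exists (idx c * bool)%type, (fun k => cov k.1 `&` (pi @` chart k.2)), fst, snd,
  (fun k s => F k.1 (repr s) - l * (turns k.2 (repr s))%:~R).
have fE (k : idx c * bool) y :
    F k.1 (repr (pi y)) - l * (turns k.2 (repr (pi y)))%:~R =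
    F k.1 y - l * (turns k.2 y)%:~R.
  have [n ->] := repr_translate a y; rewrite /F pi_translate Gn.
  rewrite turns_translate rmorphD /=; lra.
split.
- move=> k; apply: openI; first exact: cov_open.
  by apply: open_pi; exact: chart_open.
- move=> s; have [i si] := chart_cover s.
  by exists (io s, i); split; first exact: Hio.
- by move=> k; split => s [].
- move=> k x [kx ix].
  apply: (@laff_near R d (fun y => F k.1 y - l * (turns k.2 y)%:~R)).
    by apply: filterE => y; rewrite fE.
  by apply: laffB; [exact: lG | exact: turns_laff].
- move=> k k' s [ks is_] [ks' is'].
  have {1 2}<- : pi (repr s) = s by rewrite /hopf_pi reprK.
  rewrite /= flat_transE /F; set y := repr s.
  have yE : pi y = s by rewrite /hopf_pi reprK.
  rewrite yE -(transD ks (Hio s) ks') (transN (Hio s) ks') rmorphB /=; lra.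
Unshelve. all: by end_near.
Qed.

End Flat.

(** * Sections of flat line bundles *)

Section Divisor.
Variables (R : realType) (d : nat) (a : 'I_d -> R).
Hypothesis ha : forall i, 0 < a i.
Local Notation X := (set_type (@punctured R d)).
Implicit Types (x y z : X) (g h : X -> R) (n m : int).
Local Notation pi := (@hopf_pi R d a).
Local Notation height := (height ha).
Local Notation translate := (translate a).
Local Notation chart := (@chart R d a ha).

Lemma lin_fin v x : finite_pt x -> lin v x \is a fin_num.
Proof.
move=> fx; have : iaff 0 v x \is a fin_num by rewrite iaff_affR_fin.
by rewrite /iaff add0e.
Qed.

(** Weights are invariant under the translation and under the addition of a
    constant: only the affine part of the local expression changes. *)
Lemma div_weight_translate (f g : X -> R) (e : R) n x m :
  (\forall y \near x, finite_pt y -> f (translate n y) = g y + e) ->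
  div_weight f (translate n x) m -> div_weight g x m.
Proof.
move=> fg [[fnx [v [c [k [pv Hf]]]]]|[i [c [k [xi xj km Hf]]]]].
- have fx : finite_pt x by move=> i; have := fnx i; rewrite translate_pinfty.
  left; split => //; exists v, (c + translate_const a n k - e), k; split => //.
  have {}Hf := near_translate Hf; have fy_ := near_finite fx.
  near=> y; have fy : finite_pt y by near: y.
  have fgy : finite_pt y -> f (translate n y) = g y + e by near: y.
  have {fgy} : f (translate n y) = g y + e by exact: fgy.
  have -> : f (translate n y) = fine (iaff c k (translate n y)) + m%:~R *
    Num.min 0 (fine (lin v (translate n y)) - fine (lin v (translate n x))).
    by near: y.
  rewrite iaff_translate !iaff_affR_fin// !lin_translate !fineD ?lin_fin//=.
  rewrite opprD addrACA subrr addr0 /affR.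
  by move=> E; lra.
- right; exists i, (c + translate_const a n k - e), k; split => //.
  + by apply/eqP; rewrite -(translate_pinfty a n) xi.
  + by move=> j /xj; rewrite translate_pinfty.
  have {}Hf := near_translate Hf.
  near=> y => fy.
  have fgy : finite_pt y -> f (translate n y) = g y + e by near: y.
  have Hfy : finite_pt (translate n y) ->
    f (translate n y) = fine (iaff c k (translate n y)) by near: y.
  have := Hfy (translate_finite _ _ fy); rewrite (fgy fy).
  by rewrite iaff_translate !iaff_affR_fin//= /affR => E; lra.
Unshelve. all: by end_near.
Qed.

Lemma bigmin_seqE (I : eqType) (s : seq I) (F : I -> \bar R) (i : I) :
  i \in s -> (forall j, j \in s -> (F i <= F j)%E) ->
  \big[Order.min/+oo%E]_(j <- s) F j = F i.
Proof.
move=> si Fi; apply/le_anti/andP; split; last first.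
  rewrite big_seq; elim/big_ind: _ => //; first exact: leey.
  by move=> u v Fu Fv; rewrite le_min Fu Fv.
elim: s si {Fi} => // j s IHs; rewrite inE big_cons ge_min => /orP[/eqP ->|/IHs ->].
  by rewrite lexx.
by rewrite orbT.
Qed.

Variable l : R.

Lemma scale_ex : exists K : nat, forall i, 4 * `|l| <= K%:R * a i.
Proof.
pose B := \sum_i 4 * `|l| / a i.
exists (Num.truncn B).+1 => i; rewrite -ler_pdivrMr//.
apply: (@le_trans _ _ B); last by rewrite ltW// truncnS_gt.
rewrite /B (bigD1 i)//= lerDl sumr_ge0// => j _.
by rewrite divr_ge0// ?mulr_ge0// ltW.
Qed.

(** A slope steep enough for the wall, of width about |l| / scale, to stay within
    the heights between 1/2 and 1. *)
Definition scale : nat := sval (cid scale_ex).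

Lemma scaleP i : 4 * `|l| <= scale%:R * a i.
Proof. exact: (svalP (cid scale_ex)). Qed.

(** The polynomial min(0, t + K (x_i - 3/4 a_i)), with K = scale; its corner locus
    is close to the locus of height 3/4. *)
Definition wall_poly (t : R) : tpoly R d :=
  (0, fun=> 0%N) ::
  [seq (t - scale%:R * (3 / 4 * a i), fun j => if j == i then scale else 0%N)
     | i <- enum 'I_d].

Definition wall_term x i : R := scale%:R * (fine (coord x i) - 3 / 4 * a i).

Lemma wall_eval (t : R) x : finite_pt x -> tpoly_eval (wall_poly t) x =
  Order.min 0%E (\big[Order.min/+oo%E]_(i <- enum 'I_d) (t + wall_term x i)%:E).
Proof.
move=> fx; rewrite /tpoly_eval /wall_poly big_cons big_map; congr (Order.min _ _).
  rewrite iaff_affR_fin// /affR big1 ?addr0// => i _.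
  by rewrite mul0r.
apply: eq_bigr => i _; rewrite iaff_affR_fin// /affR (bigD1 i)//= eqxx big1.
  by rewrite /wall_term; congr (_%:E); rewrite -pmulrn; ring.
by move=> j /negbTE ->; rewrite mul0r.
Qed.

Definition wall_fun : X -> R := trat (wall_poly 0) (wall_poly (- l)).

(** Above height 1 all terms of both polynomials are nonnegative. *)
Lemma wall_fun_hi x : finite_pt x -> 1 < height x -> wall_fun x = 0.
Proof.
move=> fx /lt_height hx; rewrite /wall_fun /trat.
have E t : `|t| <= `|l| -> tpoly_eval (wall_poly t) x = 0%E.
  move=> tl; rewrite wall_eval//; apply/min_idPl.
  elim/big_ind: _ => [|u v Fu Fv|i _]; first exact: leey.
    by rewrite le_min Fu Fv.
  rewrite lee_fin /wall_term; have := hx i; rewrite coord_fine ?fx// lte_fin mul1r.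
  move: (fine _) => r ar; have := scaleP i.
  have : scale%:R * (a i / 4) <= scale%:R * (r - 3 / 4 * a i).
    by rewrite ler_wpM2l//; lra.
  have := ler_norm (- t); rewrite normrN /=; lra.
by rewrite !E ?normrN ?normr0// subrr.
Qed.

(** Below height 1/2 both minima are attained at the same nonconstant term, and
    these terms differ by l. *)
Lemma wall_fun_lo x : finite_pt x -> height x < 1 / 2 -> wall_fun x = l.
Proof.
move=> fx /height_lt[i1 hx]; rewrite /wall_fun /trat.
case: (Order.TotalTheory.arg_minP (wall_term x) (erefl : predT i1)) => i _ mini.
have wi : wall_term x i <= - `|l|.
  apply: le_trans (mini i1 isT) _; have := scaleP i1; move: hx.
  rewrite coord_fine ?fx// lte_fin /wall_term; move: (fine _) => r ra.
  have : scale%:R * (r - 3 / 4 * a i1) <= scale%:R * (- (a i1 / 4)).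
    by rewrite ler_wpM2l//; lra.
  lra.
have E t : `|t| <= `|l| -> tpoly_eval (wall_poly t) x = (t + wall_term x i)%:E.
  move=> tl; rewrite wall_eval// (@bigmin_seqE _ _ _ i) ?mem_enum//.
    by apply/min_idPr; rewrite lee_fin; have := ler_norm t; lra.
  by move=> j _; rewrite lee_fin lerD2l mini.
by rewrite !E ?normrN ?normr0//=; lra.
Qed.

(** Two lifts in charts of a point differ by at most one translation; if they
    differ, one of them is below height 1/2 and the other above height 1. *)
Lemma wall_fun_jump (i j : bool) n x : finite_pt x -> chart i x ->
  chart j (translate n x) -> wall_fun x - wall_fun (translate n x) = l * n%:~R.
Proof.
move=> fx xi; rewrite /chart /= height_translate => xj.
have fnx := translate_finite a n fx.
have n2 : (n < 2)%R.
  rewrite -(ltr_int R); move: xi xj; rewrite /chart /start /=.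
  by case: i; case: j; lra.
have n2' : (- 2%:Z < n)%R.
  rewrite -(ltr_int R); move: xi xj; rewrite /chart /start /=.
  by case: i; case: j; rewrite rmorphN /=; lra.
have [n0|[n1|n1]] : n = 0 \/ n = 1 \/ n = - 1 by lia.
- by rewrite n0 translate0 subrr mulr0.
- rewrite n1 in xj fnx *; rewrite wall_fun_lo// ?wall_fun_hi//.
  + by rewrite subr0 mulr1.
  + rewrite height_translate; move: xi xj; rewrite /chart /start /=.
    by case: i; case: j; lra.
  + by move: xi xj; rewrite /chart /start /=; case: i; case: j; lra.
- rewrite n1 in xj fnx *; rewrite wall_fun_hi// ?wall_fun_lo//.
  + by rewrite sub0r mulrN1.
  + rewrite height_translate; move: xi xj; rewrite /chart /start /=.
    by case: i; case: j; lra.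
  + by move: xi xj; rewrite /chart /start /=; case: i; case: j; lra.
Qed.

(** The same rational function on both charts has differences on the overlaps
    equal to the flat cocycle, and its divisor is well defined on S. *)
Lemma flat_class_section : has_section (flat_class ha l).
Proof.
exists (fun s m => exists i x, [/\ chart i x, pi x = s & div_weight wall_fun x m]).
exists (flat ha l); split => //.
exists chart, (fun=> wall_poly 0), (fun=> wall_poly (- l)); split.
- move=> i; split => //; first exact: chart_open.
  exact: chart_inj.
- move=> i x m xi; split; last by exists i, x.
  move=> [j [y [yj /esym/pi_eq[n yE] wy]]].
  rewrite yE in wy yj.
  apply: (@div_weight_translate wall_fun _ (- (l * n%:~R)) n) wy.
  have nj : \forall z \near x, chart j (translate n z).
    by apply: near_translate; apply: open_nbhs_nbhs; split => //; exact: chart_open.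
  have ni : \forall z \near x, chart i z.
    by apply: open_nbhs_nbhs; split => //; exact: chart_open.
  near=> z => fz.
  have zi : chart i z by near: z.
  have zj : chart j (translate n z) by near: z.
  have := wall_fun_jump fz zi zj; rewrite /wall_fun; lra.
- move=> i j x y xi yj fx /pi_eq[n yE]; rewrite yE in yj *.
  have tj : turns ha j x = - n.
    by apply/eqP; rewrite -addr_eq0 -turns_translate turns_chart.
  apply: etrans (esym (wall_fun_jump fx xi yj)).
  by rewrite [LHS]flat_transE turns_chart// tj opprK add0r.
Unshelve. all: by end_near.
Qed.

End Divisor.

Theorem theoremF (R : realType) (d : nat) (a : 'I_d -> R)
    (hd : (1 < d)%N) (ha : forall i, 0 < a i) :
  (exists f : {additive Pic a -> R}, bijective f) /\
  (forall L : Pic a, has_section L).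
Proof.
have [f Lf] := choice (flat_class_surj ha hd).
split; last by move=> L; rewrite (Lf L); exact: flat_class_section.
have fK : cancel (flat_class ha) f.
  by move=> l; apply: (flat_class_inj hd (ha := ha)); rewrite -Lf.
have fB : zmod_morphism f.
  move=> L M; apply: (flat_class_inj hd (ha := ha)); rewrite -Lf.
  apply: (addIr M); rewrite subrK {2}(Lf M) -flat_classD subrK.
  exact: Lf.
pose fA := GRing.isZmodMorphism.Build (Pic a) R f fB.
exists (HB.pack f fA : {additive Pic a -> R}); exists (flat_class ha) => //= L.
Qed.
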